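(* Let $n\ge2$ and let $\phi=(\phi_1,\dots,\phi_n):\mathbb{D}\to\mathbb{B}$ be a holomorphic map into the unit ball $\mathbb{B}$ of $\mathbb{C}^n$ with $\phi(0)=0$. Then the image (push-forward) $\mu$ under $\phi$ of the measure $(1-|z|^2)^{n-2}\,d\lambda(z)$ on $\mathbb{D}$ is a Carleson measure in $\mathbb{B}$.
   Context: $\mathbb{D}$ is the open unit disc of $\mathbb{C}$, $\mathbb{B}$ the open unit ball of $\mathbb{C}^n$, and $\lambda$ is Lebesgue area measure on $\mathbb{D}$. The image measure $\mu$ is defined by $\int_{\mathbb{B}}f\,d\mu=\int_{\mathbb{D}}f(\phi(z))(1-|z|^2)^{n-2}\,d\lambda(z)$ for all $f\in\mathcal{C}(\overline{\mathbb{B}})$. For $\zeta\in\partial\mathbb{B}$ and $\delta>0$ let $Q(\zeta,\delta):=\{z\in\mathbb{B}: |1-\zeta\cdot\overline{z}|<\delta\}$, where $\zeta\cdot\overline z=\sum_j\zeta_j\overline{z_j}$. A positive finite Borel measure $\mu$ on $\mathbb{B}$ is a Carleson measure if there is a constant $C$ with $\mu(Q(\zeta,\delta))\le C\delta^n$ for all $\zeta\in\partial\mathbb{B}$ and all $\delta>0$. *)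

(* Defs.v *)
From HB Require Import structures.
From mathcomp Require Import all_boot all_order all_algebra.
From mathcomp Require Import all_classical all_reals all_analysis.
From mathcomp Require Export complex.

Set Implicit Arguments.
Unset Strict Implicit.
Unset Printing Implicit Defensive.

Import Order.TTheory GRing.Theory Num.Theory.
Import numFieldNormedType.Exports.

Local Open Scope classical_set_scope.
Local Open Scope ring_scope.
Local Open Scope complex_scope.

(* [R[i]^o] is [R[i]] with its structure of normed module over itself; it is
   the copy of the complex numbers that carries a topology. *)
Notation Cvec R n := 'rV[R[i]^o]_n.

Definition borel (T : topologicalType) := g_sigma_algebraType (@open T).

Section carleson.
Variable R : realType.

Definition unit_disc : set R[i] := [set z | `|z| < 1].

(* Derivability in [R[i]^o] is with respect to complex increments. *)
Definition holomorphic_on_disc n (phi : R[i] -> Cvec R n) :=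
  forall (j : 'I_n) (z : R[i]), unit_disc z ->
    derivable ((fun w => phi w ord0 j) : R[i]^o -> R[i]^o) z 1.

Section ball.
Variable n : nat.

(* The library norm on matrices is the maximum norm, not the Euclidean one. *)
Definition unit_ball : set (Cvec R n) :=
  [set z | \sum_(j < n) `|z ord0 j| ^+ 2 < 1].

Definition unit_sphere : set (Cvec R n) :=
  [set z | \sum_(j < n) `|z ord0 j| ^+ 2 = 1].

Definition hdot (x y : Cvec R n) : R[i] :=
  \sum_(j < n) x ord0 j * (y ord0 j)^*.

Definition carleson_region (zeta : Cvec R n) (delta : R) : set (Cvec R n) :=
  [set z | unit_ball z /\ `|1 - hdot zeta z| < delta%:C].

(* Measures on [unit_ball] are represented by Borel measures on the whole space
   for which the complement of the ball is null; set functions are compared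
   only on Borel sets. *)
Definition finite_borel_measure_on_ball (mu : set (borel (Cvec R n)) -> \bar R) :=
  (exists m : {finite_measure set (borel (Cvec R n)) -> \bar R},
     forall A, measurable A -> mu A = m A) /\
  mu (~` unit_ball) = 0%E.

Definition carleson_measure (mu : set (borel (Cvec R n)) -> \bar R) :=
  finite_borel_measure_on_ball mu /\
  exists C : R, forall (zeta : Cvec R n) (delta : R),
    unit_sphere zeta -> 0 < delta ->
    (mu (carleson_region zeta delta) <= (C * delta ^+ n)%:E)%E.

End ball.

Definition complex_of_pair (p : R * R) : R[i] := p.1 +i* p.2.

(* The measure (1 - |z|^2)^(n-2) dlambda(z) on the disc, in the real coordinates
   z = x + iy; the exponent is only meaningful for n >= 2. *)
Definition weighted_area (n : nat) :
    set (measurableTypeR R * measurableTypeR R)%type -> \bar R :=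
  fun A => (\int[lebesgue_measure \x lebesgue_measure]_(p in
      (complex_of_pair @^-1` unit_disc) `&` A)
    ((1 - (p.1 ^+ 2 + p.2 ^+ 2)) ^+ (n - 2))%:E)%E.

(* The values of [phi] outside the disc are irrelevant, since [weighted_area]
   does not charge the complement of the disc. *)
Definition image_measure n (phi : R[i] -> Cvec R n) :
    set (borel (Cvec R n)) -> \bar R :=
  pushforward (weighted_area n)
    ((phi \o complex_of_pair) :
       (measurableTypeR R * measurableTypeR R)%type -> borel (Cvec R n)).

End carleson.

(* Main.v *)
Require Import Defs.
From HB Require Import structures.
From mathcomp Require Import all_boot all_order all_algebra.
From mathcomp Require Import all_classical all_reals all_analysis.
From mathcomp Require Import measurable_realfun complex.
From mathcomp Require Import ring lra.

Import Order.TTheory GRing.Theory Num.Theory.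
Import numFieldNormedType.Exports.

Local Open Scope classical_set_scope.
Local Open Scope ring_scope.

Set Implicit Arguments.
Unset Strict Implicit.
Unset Printing Implicit Defensive.

(** Fix [zeta] on the sphere and put [f z = (zeta . conj (phi z))^*] ([slice]).
    This is a holomorphic function on the disc with [f 0 = 0] and [|f| <= 1], and
    [phi z] lies in the region [Q(zeta, d)] exactly when [|1 - f z| < d].  By the
    Schwarz lemma [|f z| <= |z|], so all such [z] lie in the annulus
    [1 - d <= |z| < 1], where the weight [(1 - |z|^2)^(n-2)] is at most
    [(2d)^(n-2)].  Everything thus reduces to a bound [32 d^2], uniform in
    [zeta], for the area of the set where [|1 - f| < d] ([area_near_one]).

    On a circle centred at the origin this set has proportion at most [4d]
    ([circle_near_one]): the function [u = Re (1 / (1 + d - f))] is positive and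
    harmonic, its mean over the circle is [u 0 = 1 / (1 + d) <= 1], and
    [u >= 1 / (4d)] wherever [|1 - f| < d].  As plane Lebesgue measure is
    invariant under rotations, Tonelli's theorem integrates this bound over the
    annulus ([rotation_average]), whose area is at most [8d]
    ([area_annulus_le]).

    The mean value property ([circle_mean]) comes from Goursat's lemma, applied to
    [w |-> g (a + k exp w)] on the rectangle [s0, 0] x [0, 2 pi]: by periodicity
    the two horizontal sides cancel, so that the mean of [g] over the circle of
    radius [|k| exp s] does not depend on [s], and [s] tends to minus infinity.
    The centre [a] is reached only in the limit, through continuity of [g] there.
    This makes the mean value property, and with it the maximum principle,
    available for [f z / z] without a removable singularity theorem, which is all
    that the Schwarz lemma requires ([schwarz_lemma]).  Goursat's lemma itself
    is proved by bisection for real 1-forms [P dx + Q dy] that are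
    differentiable at each point, with [dP/dy = dQ/dx]. *)

(** * Bisection of rectangles *)

Section Goursat.
Variable R : realType.
Implicit Types (J : R -> R -> R -> R -> R).

(** Additivity under cutting a subrectangle of [a, b] x [c, d] into four equal
    parts; the arguments of [J] are left, right, bottom, top. *)
Definition quartering J a b c d :=
  forall a' b' c' d', a <= a' -> a' < b' -> b' <= b ->
    c <= c' -> c' < d' -> d' <= d ->
  let m := (a' + b') / 2 in let k := (c' + d') / 2 in
  J a' b' c' d' = J a' m c' k + J m b' c' k + J a' m k d' + J m b' k d'.

(** Near each point, [J] is small compared with the square of the size of the
    rectangle.  Only rectangles containing the point are constrained, as is the
    case for the estimate that differentiability at the point provides. *)
Definition locally_negligible J a b c d :=
  forall x y, a <= x <= b -> c <= y <= d -> forall e, 0 < e ->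
  exists2 r, 0 < r & forall a' b' c' d',
    a <= a' -> a' <= x <= b' -> b' <= b -> c <= c' -> c' <= y <= d' -> d' <= d ->
    b' - a' < r -> d' - c' < r ->
    `|J a' b' c' d'| <= e * ((b' - a') + (d' - c')) ^+ 2.

(** If all four quarters, which have half the perimeter, violated the lower bound,
    their sum would be less than [4 * (M * s / 4)]. *)
Lemma large_quarter J a b c d M : a < b -> c < d -> quartering J a b c d ->
  let m := (a + b) / 2 in let k := (c + d) / 2 in
  M * ((b - a) + (d - c)) ^+ 2 <= `|J a b c d| ->
  [\/ M * ((m - a) + (k - c)) ^+ 2 <= `|J a m c k|,
      M * ((b - m) + (k - c)) ^+ 2 <= `|J m b c k|,
      M * ((m - a) + (d - k)) ^+ 2 <= `|J a m k d|
    | M * ((b - m) + (d - k)) ^+ 2 <= `|J m b k d|].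
Proof.
move=> ab cd Jq m k; rewrite Jq //.
have -> : b - m = (b - a) / 2 by rewrite /m; field.
have -> : m - a = (b - a) / 2 by rewrite /m; field.
have -> : d - k = (d - c) / 2 by rewrite /k; field.
have -> : k - c = (d - c) / 2 by rewrite /k; field.
set s := (X in M * X <= _).
have -> : ((b - a) / 2 + (d - c) / 2) ^+ 2 = s / 4 by rewrite /s; field.
move=> H.
have [?|h1] := leP (M * (s / 4)) `|J a m c k|; first by apply: Or41.
have [?|h2] := leP (M * (s / 4)) `|J m b c k|; first by apply: Or42.
have [?|h3] := leP (M * (s / 4)) `|J a m k d|; first by apply: Or43.
have [?|h4] := leP (M * (s / 4)) `|J m b k d|; first by apply: Or44.
have := ler_normD (J a m c k + J m b c k + J a m k d) (J m b k d).
have := ler_normD (J a m c k + J m b c k) (J a m k d).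
have := ler_normD (J a m c k) (J m b c k).
lra.
Qed.

Record rect := Rect { rl : R; rr : R; rb : R; rt : R }.

Definition halves (q' q : rect) := [/\ rl q <= rl q', rr q' <= rr q,
  rb q <= rb q', rt q' <= rt q & rr q' - rl q' = (rr q - rl q) / 2 /\
  rt q' - rb q' = (rt q - rb q) / 2].

Lemma nested_halves (q : nat -> rect) :
    rl (q 0) < rr (q 0) -> rb (q 0) < rt (q 0) ->
    (forall n, halves (q n.+1) (q n)) ->
  exists x y, (forall n, [/\ rl (q n) <= x <= rr (q n) & rb (q n) <= y <= rt (q n)])
  /\ forall r, 0 < r -> exists n, rr (q n) - rl (q n) < r /\ rt (q n) - rb (q n) < r.
Proof.
move=> lr bt hq.
have wn n : rr (q n) - rl (q n) = (rr (q 0) - rl (q 0)) / 2 ^+ n /\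
            rt (q n) - rb (q n) = (rt (q 0) - rb (q 0)) / 2 ^+ n.
  elim: n => [|n [h1 h2]]; first by rewrite expr0 !divr1.
  have [_ _ _ _ [-> ->]] := hq n; rewrite h1 h2 exprSr invfM; lra.
have wn0 n : rl (q n) < rr (q n) /\ rb (q n) < rt (q n).
  by split; rewrite -subr_gt0 (wn n).1 || rewrite -subr_gt0 (wn n).2;
    rewrite divr_gt0 ?exprn_gt0 // subr_gt0.
have mono n m : (n <= m)%N -> [/\ rl (q n) <= rl (q m), rr (q m) <= rr (q n),
    rb (q n) <= rb (q m) & rt (q m) <= rt (q n)].
  elim: m => [|m ih]; first by rewrite leqn0 => /eqP ->.
  rewrite leq_eqVlt => /predU1P[->//|]; rewrite ltnS => /ih[h1 h2 h3 h4].
  by have [? ? ? ? _] := hq m; split; [move: h1|move: h2|move: h3|move: h4]; lra.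
have lle n m : rl (q n) <= rr (q m) /\ rb (q n) <= rt (q m).
  have [nm|/ltnW nm] := leqP n m; have [? ? ? ?] := mono _ _ nm.
    by have [? ?] := wn0 m; split; lra.
  by have [? ?] := wn0 n; split; lra.
exists (sup [set rl (q n) | n in setT]), (sup [set rb (q n) | n in setT]); split.
  move=> n; split; apply/andP; split.
  - by apply: ub_le_sup; [exists (rr (q 0)) => _ [m _ <-]; exact: (lle m _).1|exists n].
  - by apply: ge_sup; [exists (rl (q 0)), 0|move=> _ [m _ <-]; exact: (lle m n).1].
  - by apply: ub_le_sup; [exists (rt (q 0)) => _ [m _ <-]; exact: (lle m _).2|exists n].
  - by apply: ge_sup; [exists (rb (q 0)), 0|move=> _ [m _ <-]; exact: (lle m n).2].
move=> r r0; set D := (rr (q 0) - rl (q 0)) + (rt (q 0) - rb (q 0)).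
have D0 : 0 < D by rewrite /D; lra.
have [n hn] : exists n, D / r < 2 ^+ n.
  exists (Num.truncn (D / r)).+1; apply: lt_trans (truncnS_gt _) _.
  by rewrite -natrX ltr_nat ltn_expl.
have h2 : D / 2 ^+ n < r.
  by rewrite ltr_pdivrMr ?exprn_gt0 // mulrC -ltr_pdivrMr.
have i0 : 0 < (2 ^+ n : R)^-1 by rewrite invr_gt0 exprn_gt0.
exists n; rewrite (wn n).1 (wn n).2; split; apply: le_lt_trans h2;
  rewrite ler_pM2r // /D; lra.
Qed.

(** A nonzero value of [J] would produce nested rectangles on which [|J|] stays at
    least [M] times the squared size; at their common point this contradicts
    [locally_negligible]. *)
Lemma goursat_bisection J a b c d : a < b -> c < d ->
  quartering J a b c d -> locally_negligible J a b c d -> J a b c d = 0.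
Proof.
move=> ab cd Jq Jn; apply: contrapT => /eqP J0.
set S := (b - a) + (d - c); have S0 : 0 < S by rewrite /S; lra.
set M := `|J a b c d| / S ^+ 2.
have M0 : 0 < M by rewrite divr_gt0 ?normr_gt0 ?exprn_gt0.
pose bad q := [/\ a <= rl q, rl q < rr q & rr q <= b] /\
  [/\ c <= rb q, rb q < rt q, rt q <= d &
  M * ((rr q - rl q) + (rt q - rb q)) ^+ 2 <= `|J (rl q) (rr q) (rb q) (rt q)|].
have step q : exists q', bad q -> bad q' /\ halves q' q.
  have [[[a1 a2 a3] [c1 c2 c3 Jge]]|nb] := pselect (bad q); last by exists q.
  have Jq' : quartering J (rl q) (rr q) (rb q) (rt q).
    move=> a' b' c' d' h1 h2 h3 h4 h5 h6; apply: Jq => //; lra.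
  set m := (rl q + rr q) / 2; set k := (rb q + rt q) / 2.
  have [hm1 hm2] : rl q < m /\ m < rr q by rewrite /m; lra.
  have [hk1 hk2] : rb q < k /\ k < rt q by rewrite /k; lra.
  have [H|H|H|H] := large_quarter a2 c2 Jq' Jge.
  - exists (Rect (rl q) m (rb q) k); rewrite /bad /halves /= => _.
    split; split; rewrite ?H /=; try split; rewrite ?lexx // ?(ltW hm2) ?(ltW hk2) //;
    by rewrite /m /k; lra.
  - exists (Rect m (rr q) (rb q) k); rewrite /bad /halves /= => _.
    split; split; rewrite ?H /=; try split; rewrite ?lexx // ?(ltW hm1) ?(ltW hk2) //;
    by rewrite /m /k; lra.
  - exists (Rect (rl q) m k (rt q)); rewrite /bad /halves /= => _.
    split; split; rewrite ?H /=; try split; rewrite ?lexx // ?(ltW hm2) ?(ltW hk1) //;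
    by rewrite /m /k; lra.
  - exists (Rect m (rr q) k (rt q)); rewrite /bad /halves /= => _.
    split; split; rewrite ?H /=; try split; rewrite ?lexx // ?(ltW hm1) ?(ltW hk1) //;
    by rewrite /m /k; lra.
have [next nextP] := choice step.
pose q n := iter n next (Rect a b c d).
have bad0 : bad (Rect a b c d).
  split; split => //=; rewrite -/S /M divfK //.
  by rewrite expf_neq0 // gt_eqF.
have badn n : bad (q n) by elim: n => //= n /nextP[].
have [x [y [xy small]]] := @nested_halves q ab cd (fun n => (nextP _ (badn n)).2).
have [/= x0 y0] := xy 0%N.
have [r r0 hr] := Jn x y x0 y0 (M / 2) (divr_gt0 M0 (ltr0n _ 2)).
have [n [w h]] := small r r0.
have [[a1 a2 a3] [c1 c2 c3 Jge]] := badn n.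
have [hx hy] := xy n.
have := hr _ _ _ _ a1 hx a3 c1 hy c3 w h.
move/(le_trans Jge); apply/negP; rewrite -ltNge.
set T := (_ + _) ^+ 2; have T0 : 0 < T by rewrite exprn_gt0 //; lra.
by rewrite ltr_pM2r //; lra.
Qed.

End Goursat.

(** * Goursat's lemma for closed 1-forms *)

Section IntervalIntegral.
Variable R : realType.
Implicit Types (f g : R -> R) (a b : R).
Local Notation mu := (@lebesgue_measure R).

Lemma itv_integrable f a b : (forall x, a <= x <= b -> {for x, continuous f}) ->
  mu.-integrable `[a, b] (EFin \o f).
Proof.
move=> cf; apply: continuous_compact_integrable; first exact: segment_compact.
apply/continuous_in_subspaceT => x; rewrite inE /= in_itv /= => h; exact: cf.
Qed.

Lemma itv_integral_split f a m b : a <= m -> m <= b ->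
  (forall x, a <= x <= b -> {for x, continuous f}) ->
  \int[mu]_(x in `[a, b]) f x =
    \int[mu]_(x in `[a, m]) f x + \int[mu]_(x in `[m, b]) f x.
Proof.
move=> am mb cf.
have := @Rintegral_itvB R f (BLeft a) (BRight b) m (itv_integrable cf).
rewrite !bnd_simp => /(_ am mb).
rewrite Rintegral_itv_obnd_cbnd; first by move=> <-; rewrite addrC subrK.
apply: integrableS (itv_integrable cf) => //.
by move=> x /=; rewrite !in_itv /= => /andP[/ltW/(le_trans am) -> ->].
Qed.

Lemma itv_integral_cst a b k : a <= b -> \int[mu]_(x in `[a, b]) k = k * (b - a).
Proof.
move=> ab; rewrite Rintegral_cst //= lebesgue_measure_itv /= lte_fin.
by case: ltgtP ab => //= -> _; rewrite subrr.
Qed.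

(** The error bound is linear in the length, so that integrating over the sides of
    a small rectangle produces an error quadratic in its size. *)
Lemma itv_integral_approx f a b k e : a <= b ->
  (forall x, a <= x <= b -> {for x, continuous f}) ->
  (forall x, a <= x <= b -> `|f x - k| <= e) ->
  `|\int[mu]_(x in `[a, b]) f x - k * (b - a)| <= e * (b - a).
Proof.
move=> ab cf fe; rewrite ler_distl.
rewrite -mulrBl -mulrDl -!itv_integral_cst //.
have ci k' : mu.-integrable `[a, b] (EFin \o (fun=> k')).
  by apply: itv_integrable => x _; exact: cst_continuous.
apply/andP; split; apply: le_Rintegral => //; try exact: itv_integrable.
  by move=> x /=; rewrite in_itv /= => /fe; rewrite ler_distl => /andP[].
by move=> x /=; rewrite in_itv /= => /fe; rewrite ler_distl => /andP[].
Qed.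

Definition frechet2 (P : R -> R -> R) x y p q := forall e, 0 < e ->
  exists2 r, 0 < r & forall x' y', `|x' - x| < r -> `|y' - y| < r ->
    `|P x' y' - P x y - (p * (x' - x) + q * (y' - y))| <=
      e * (`|x' - x| + `|y' - y|).

Lemma frechet2_continuous P x y p q : frechet2 P x y p q ->
  {for x, continuous (fun s => P s y)} /\ {for y, continuous (P x)}.
Proof.
move=> dP; have [r r0 hr] := dP 1 ltr01; split; apply/cvgrPdist_lt => e e0.
- near=> s; have hs : `|s - x| < Num.min r (e / (1 + `|p|)).
    rewrite distrC; near: s; apply: cvgr_dist_lt => //.
    by rewrite lt_min r0 divr_gt0 // ltr_wpDr.
  have := hr s y; move: hs; rewrite lt_min subrr normr0 => /andP[hs hs2].
  move=> /(_ hs r0); rewrite mul1r mulr0 !addr0 => h.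
  rewrite distrC; have := ler_normD (P s y - P x y - p * (s - x)) (p * (s - x)).
  rewrite subrK normrM; move: hs2; rewrite ltr_pdivlMr ?ltr_wpDr // mulrC.
  lra.
- near=> s; have hs : `|s - y| < Num.min r (e / (1 + `|q|)).
    rewrite distrC; near: s; apply: cvgr_dist_lt => //.
    by rewrite lt_min r0 divr_gt0 // ltr_wpDr.
  have := hr x s; move: hs; rewrite lt_min subrr normr0 => /andP[hs hs2].
  move=> /(_ r0 hs); rewrite mul1r mulr0 !add0r => h.
  rewrite distrC; have := ler_normD (P x s - P x y - q * (s - y)) (q * (s - y)).
  rewrite subrK normrM; move: hs2; rewrite ltr_pdivlMr ?ltr_wpDr // mulrC.
  lra.
Unshelve. all: by end_near. Qed.

(** The integral of [P dx + Q dy] along the boundary, counterclockwise.  Opposite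
    sides are paired so that constants and one of the two linear terms drop out
    of each integrand. *)
Definition circulation (P Q : R -> R -> R) a b c d : R :=
  \int[mu]_(x in `[a, b]) (P x c - P x d) +
  \int[mu]_(y in `[c, d]) (Q b y - Q a y).

Lemma ler_dist_sub (u v A B k e : R) : A - B = k ->
  `|u - A| <= e -> `|v - B| <= e -> `|u - v - k| <= e + e.
Proof.
move=> <- hu hv; have -> : u - v - (A - B) = (u - A) - (v - B) by ring.
by rewrite (le_trans (ler_normB _ _)) // lerD.
Qed.

(** Replacing [P] and [Q] by their linear parts, the two integrals are [m (c - d)]
    times the width and [m (b - a)] times the height, which cancel because both
    mixed coefficients are the same [m]. *)
Lemma circulation_small (P Q : R -> R -> R) (x y p m q e a b c d : R) : a <= b -> c <= d ->
  (forall s t, a <= s <= b -> c <= t <= d ->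
     {for s, continuous (fun s => P s t)} /\ {for t, continuous (Q s)}) ->
  (forall s t, a <= s <= b -> c <= t <= d ->
     `|P s t - (P x y + (p * (s - x) + m * (t - y)))| <= e /\
     `|Q s t - (Q x y + (m * (s - x) + q * (t - y)))| <= e) ->
  `|circulation P Q a b c d| <= (e + e) * ((b - a) + (d - c)).
Proof.
move=> ab cd cPQ ePQ.
have [ha hb] : a <= a <= b /\ a <= b <= b by rewrite !lexx ab.
have [hc hd] : c <= c <= d /\ c <= d <= d by rewrite !lexx cd.
have A1 : `|\int[mu]_(s in `[a, b]) (P s c - P s d) - (m * (c - d)) * (b - a)|
    <= (e + e) * (b - a).
  apply: itv_integral_approx => // s hs.
    by apply: continuousB; [exact: (cPQ _ _ hs hc).1|exact: (cPQ _ _ hs hd).1].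
  by apply: ler_dist_sub (ePQ _ _ hs hc).1 (ePQ _ _ hs hd).1; ring.
have A2 : `|\int[mu]_(t in `[c, d]) (Q b t - Q a t) - (m * (b - a)) * (d - c)|
    <= (e + e) * (d - c).
  apply: itv_integral_approx => // t ht.
    by apply: continuousB; [exact: (cPQ _ _ hb ht).2|exact: (cPQ _ _ ha ht).2].
  by apply: ler_dist_sub (ePQ _ _ hb ht).2 (ePQ _ _ ha ht).2; ring.
rewrite /circulation mulrDr; apply: le_trans (lerD A1 A2).
apply: le_trans (ler_normD _ _).
by rewrite le_eqVlt; apply/orP; left; apply/eqP; congr (`|_|); ring.
Qed.

Lemma circulation_quartering (P Q : R -> R -> R) (a b c d : R) :
  (forall s t, a <= s <= b -> c <= t <= d ->
     {for s, continuous (fun s => P s t)} /\ {for t, continuous (Q s)}) ->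
  quartering (circulation P Q) a b c d.
Proof.
move=> cPQ a' b' c' d' a1 a2 a3 c1 c2 c3 m k.
have [hm1 hm2] : a' <= m /\ m <= b' by rewrite /m; split; clear -a2; lra.
have [hk1 hk2] : c' <= k /\ k <= d' by rewrite /k; split; clear -c2; lra.
have sx s : a' <= s <= b' -> a <= s <= b.
  by case/andP=> s1 s2; rewrite (le_trans a1 s1) (le_trans s2 a3).
have sy t : c' <= t <= d' -> c <= t <= d.
  by case/andP=> s1 s2; rewrite (le_trans c1 s1) (le_trans s2 c3).
have [ha hb hm] : [/\ a' <= a' <= b', a' <= b' <= b' & a' <= m <= b'].
  by rewrite !lexx hm1 hm2 (ltW a2).
have [hc hd hk] : [/\ c' <= c' <= d', c' <= d' <= d' & c' <= k <= d'].
  by rewrite !lexx hk1 hk2 (ltW c2).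
have cPB s t t' : a' <= s <= b' -> c' <= t <= d' -> c' <= t' <= d' ->
    {for s, continuous (fun s => P s t - P s t')}.
  by move=> /sx ? /sy ? /sy ?; apply: continuousB; exact: (cPQ _ _ _ _).1.
have cQB t s s' : c' <= t <= d' -> a' <= s <= b' -> a' <= s' <= b' ->
    {for t, continuous (fun t => Q s t - Q s' t)}.
  by move=> /sy ? /sx ? /sx ?; apply: continuousB; exact: (cPQ _ _ _ _).2.
rewrite /circulation (itv_integral_split hm1 hm2); last by move=> x hx; exact: cPB.
rewrite (itv_integral_split hk1 hk2); last by move=> x hx; exact: cQB.
have IP t u v : c' <= t <= d' -> a' <= u -> v <= b' ->
    mu.-integrable `[u, v] (EFin \o (fun x => P x t)).
  move=> ht hu hv; apply: itv_integrable => s /andP[s1 s2].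
  by apply: (cPQ _ _ _ _).1; [rewrite sx // (le_trans hu s1) (le_trans s2 hv)|exact: sy].
have IQ s u v : a' <= s <= b' -> c' <= u -> v <= d' ->
    mu.-integrable `[u, v] (EFin \o Q s).
  move=> hs hu hv; apply: itv_integrable => t /andP[s1 s2].
  by apply: (cPQ _ _ _ _).2; [exact: sx|rewrite sy // (le_trans hu s1) (le_trans s2 hv)].
have BP t t' u v : c' <= t <= d' -> c' <= t' <= d' -> a' <= u -> v <= b' ->
    \int[mu]_(x in `[u, v]) (P x t - P x t') =
    \int[mu]_(x in `[u, v]) P x t - \int[mu]_(x in `[u, v]) P x t'.
  by move=> *; rewrite RintegralB //; exact: IP.
have BQ s s' u v : a' <= s <= b' -> a' <= s' <= b' -> c' <= u -> v <= d' ->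
    \int[mu]_(y in `[u, v]) (Q s y - Q s' y) =
    \int[mu]_(y in `[u, v]) Q s y - \int[mu]_(y in `[u, v]) Q s' y.
  by move=> *; rewrite RintegralB //; exact: IQ.
by rewrite !BP ?BQ //; ring.
Qed.

(** The hypothesis gives a common value [m] to the derivatives [dP/dy] and
    [dQ/dx]: the form is closed. *)
Theorem goursat (P Q : R -> R -> R) a b c d : a < b -> c < d ->
  (forall x y, a <= x <= b -> c <= y <= d -> exists p m q,
    frechet2 P x y p m /\ frechet2 Q x y m q) ->
  circulation P Q a b c d = 0.
Proof.
move=> ab cd dPQ.
have cPQ s t : a <= s <= b -> c <= t <= d ->
    {for s, continuous (fun s => P s t)} /\ {for t, continuous (Q s)}.
  move=> hs ht; have [p [m [q [dP dQ]]]] := dPQ _ _ hs ht.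
  by split; [exact: (frechet2_continuous dP).1|exact: (frechet2_continuous dQ).2].
apply: (goursat_bisection ab cd); first exact: circulation_quartering.
move=> x y hx hy e e0.
have [p [m [q [dP dQ]]]] := dPQ _ _ hx hy.
have e2 : 0 < e / 2 by rewrite divr_gt0.
have [r r0 hr] := dP _ e2.
have [r' r'0 hr'] := dQ _ e2.
exists (Num.min r r'); first by rewrite lt_min r0 r'0.
move=> a' b' c' d' a1 /andP[a2 a3] a4 c1 /andP[c2 c3] c4.
rewrite !lt_min => /andP[w1 w2] /andP[h1 h2].
rewrite expr2 mulrA.
have -> : e * (b' - a' + (d' - c')) = e / 2 * (b' - a' + (d' - c')) +
  e / 2 * (b' - a' + (d' - c')) by field.
apply: (circulation_small (x := x) (y := y) (p := p) (m := m) (q := q)).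
- exact: le_trans a2 a3.
- exact: le_trans c2 c3.
- move=> s t /andP[s1 s2] /andP[t1 t2]; apply: cPQ.
    by rewrite (le_trans a1 s1) (le_trans s2 a4).
  by rewrite (le_trans c1 t1) (le_trans t2 c4).
- move=> s t /andP[s1 s2] /andP[t1 t2].
  have A : `|s - x| <= b' - a'.
    by rewrite ler_norml; clear -s1 s2 a2 a3; apply/andP; split; lra.
  have B : `|t - y| <= d' - c'.
    by rewrite ler_norml; clear -t1 t2 c2 c3; apply/andP; split; lra.
  split; rewrite opprD addrA.
    apply: le_trans (hr _ _ (le_lt_trans A w1) (le_lt_trans B h1)) _.
    by rewrite ler_pM2l // lerD.
  apply: le_trans (hr' _ _ (le_lt_trans A w2) (le_lt_trans B h2)) _.
  by rewrite ler_pM2l // lerD.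
Qed.

End IntervalIntegral.

(** * Complex derivatives and the exponential map *)

(** Stated over a [numFieldType] so as to serve both for real derivatives and for
    complex ones. *)
Lemma quotient_cvgP (K : numFieldType) (f : K^o -> K^o) (x c : K^o) :
  ((fun h : K => h^-1 *: ((f \o shift x) (h *: 1) - f x)) @ 0^' --> c) <->
  (forall e, 0 < e -> exists2 r, 0 < r &
    forall k, `|k| < r -> `|f (x + k) - f x - c * k| <= e * `|k|).
Proof.
have quot k : k != 0 ->
    `|f (x + k) - f x - c * k| =
    `|c - k^-1 *: ((f \o shift x) (k *: 1) - f x)| * `|k|.
  move=> k0; rewrite distrC -normrM mulrBl; congr (`|_ - _|).
  rewrite -[_ *: _]/(_ * _) -[_ *: _]/(_ * _) mulr1 mulrAC mulVf // mul1r.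
  by rewrite /= (addrC k).
split=> [/cvgrPdist_le fc e /fc[r /= r0 hr]|fc].
  exists r => // k kr; have [->|k0] := eqVneq k 0.
    by rewrite addr0 subrr mulr0 subr0 normr0 mulr0.
  by rewrite quot // ler_pM2r ?normr_gt0 //; apply: hr; rewrite /ball_ /= ?sub0r ?normrN.
apply/cvgrPdist_le => e /fc[r r0 hr]; exists r => //= k.
rewrite /ball_ /= sub0r normrN => kr k0.
by rewrite -(ler_pM2r (_ : 0 < `|k|)) ?normr_gt0 // -quot // hr.
Qed.

Section Complex.
Variable R : realType.
Local Open Scope complex_scope.
Local Notation C := R[i].
Local Notation normc := (@Normc.normc R).
Local Notation Re := (@complex.Re R).
Local Notation Im := (@complex.Im R).
Implicit Types (z w k c : C).

Lemma norm_normc z : `|z| = (normc z)%:C. Proof. by []. Qed.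

Lemma normcM z w : normc (z * w) = normc z * normc w.
Proof. exact: Normc.normcM. Qed.

Lemma normc_ge0 z : 0 <= normc z.
Proof. by case: z => x y /=; exact: sqrtr_ge0. Qed.

Lemma normcD z w : normc (z + w) <= normc z + normc w.
Proof. by have := ler_normD z w; rewrite !norm_normc -rmorphD lecR. Qed.

Lemma normc_distC z w : normc (z - w) = normc (w - z).
Proof. by apply: (@complexI R); rewrite -!norm_normc distrC. Qed.

Lemma normc_dist_le z w : normc z <= normc w + normc (z - w).
Proof. by rewrite -{1}(subrK w z) addrC; exact: normcD. Qed.

Lemma normc_sqrtE z : normc z = Num.sqrt (Re z ^+ 2 + Im z ^+ 2).
Proof. by case: z. Qed.

Lemma normc2E z : normc z ^+ 2 = Re z ^+ 2 + Im z ^+ 2.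
Proof. by rewrite normc_sqrtE sqr_sqrtr // addr_ge0 ?sqr_ge0. Qed.

Lemma Re_le_normc z : `|Re z| <= normc z.
Proof. by rewrite normc_sqrtE -sqrtr_sqr ler_wsqrtr // lerDl sqr_ge0. Qed.

Lemma Im_le_normc z : `|Im z| <= normc z.
Proof. by rewrite normc_sqrtE -sqrtr_sqr ler_wsqrtr // lerDr sqr_ge0. Qed.

Lemma normc_le z : normc z <= `|Re z| + `|Im z|.
Proof.
rewrite -[leRHS]ger0_norm ?addr_ge0 // -sqrtr_sqr normc_sqrtE ler_wsqrtr //.
rewrite sqrrD !real_normK ?num_real // -addrA lerD2l lerDr.
by rewrite mulrn_wge0 // mulr_ge0.
Qed.

Lemma normc_real (x : R) : normc x%:C = `|x|.
Proof. by rewrite normc_sqrtE /= expr0n /= addr0 sqrtr_sqr. Qed.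

Lemma normc_gt0 z : (0 < normc z) = (z != 0).
Proof. by rewrite -ltcR -norm_normc normr_gt0. Qed.

Lemma normc_conj z : normc z^* = normc z.
Proof. by case: z => x y; rewrite /= sqrrN. Qed.

(** Complex differentiability in terms of a real-valued modulus and real
    tolerances, the form in which real and imaginary parts can be split off. *)
Definition cdiff (g : C -> C) z c := forall e, 0 < e ->
  exists2 r, 0 < r & forall k, normc k < r ->
    normc (g (z + k) - g z - c * k) <= e * normc k.

Lemma pos_complexP (e : C) : 0 < e -> exists2 x : R, 0 < x & e = x%:C.
Proof.
case: e => x y; rewrite ltcE /= => /andP[/eqP -> x0]; by exists x.
Qed.

Lemma derivable_cdiff (g : C^o -> C^o) z : derivable g z 1 ->
  exists c, cdiff g z c.
Proof.
move=> /cvg_ex[c /quotient_cvgP gc]; exists c => e e0.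
have [|_ /pos_complexP[r r0 ->] hr] := gc e%:C; first by rewrite ltcR.
exists r => // k kr; move: (hr k).
by rewrite !norm_normc -rmorphM ltcR lecR; apply.
Qed.

Lemma cdiff_derivable (g : C^o -> C^o) z c : cdiff g z c -> derivable g z 1.
Proof.
move=> dg; apply/cvg_ex; exists (c : C^o).
apply/quotient_cvgP => _ /pos_complexP[e e0 ->].
have [r r0 hr] := dg _ e0; exists r%:C; first by rewrite ltcR.
by move=> k; rewrite !norm_normc -rmorphM ltcR lecR; exact: hr.
Qed.

(** The Cauchy-Riemann equations: the mixed coefficients [Re c] agree, so that
    [Im g ds + Re g dt] is a closed form. *)
Lemma cdiff_frechet2 (g : C -> C) (x y : R) c : cdiff g (x +i* y) c ->
  frechet2 (fun s t => Im (g (s +i* t))) x y (Im c) (Re c) /\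
  frechet2 (fun s t => Re (g (s +i* t))) x y (Re c) (- Im c).
Proof.
move=> dg; suff H e : 0 < e -> exists2 r, 0 < r & forall x' y',
    `|x' - x| < r -> `|y' - y| < r ->
    normc (g (x' +i* y') - g (x +i* y) - c * ((x' - x) +i* (y' - y))) <=
    e * (`|x' - x| + `|y' - y|).
  split=> e e0; have [r r0 hr] := H _ e0; exists r => // x' y' hx hy;
    apply: le_trans (hr _ _ hx hy).
    apply: le_trans (Im_le_normc _); rewrite le_eqVlt; apply/orP; left; apply/eqP.
    congr (`|_|); case: (g _) => ? ?; case: (g _) => ? ?; case: (c) => ? ? /=; ring.
  apply: le_trans (Re_le_normc _); rewrite le_eqVlt; apply/orP; left; apply/eqP.
  congr (`|_|); case: (g _) => ? ?; case: (g _) => ? ?; case: (c) => ? ? /=; ring.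
move=> e0; have [r r0 hr] := dg _ e0; exists (r / 2); first by rewrite divr_gt0.
move=> x' y' hx hy; have hk := normc_le ((x' - x) +i* (y' - y)).
have -> : x' +i* y' = x +i* y + ((x' - x) +i* (y' - y)).
  by apply/eqP; rewrite eq_complex /=; apply/andP; split; apply/eqP; ring.
apply: le_trans (hr _ _) _.
  by apply: le_lt_trans hk _; rewrite [ltRHS]splitr ltrD.
by rewrite ler_pM2l.
Qed.

Definition cexp (z : C) : C := (expR (Re z) * cos (Im z)) +i* (expR (Re z) * sin (Im z)).

Lemma cexpD z w : cexp (z + w) = cexp z * cexp w.
Proof.
case: z => a b; case: w => c d; rewrite /cexp /= expRD cosD sinD.
by apply/eqP; rewrite eq_complex /=; apply/andP; split; apply/eqP; ring.
Qed.

Lemma normc_cexp z : normc (cexp z) = expR (Re z).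
Proof.
rewrite normc_sqrtE /= !exprMn -mulrDr cos2Dsin2 mulr1 sqrtr_sqr ger0_norm // expR_ge0.
Qed.

Lemma is_derive_approx (f : R -> R) (x d e : R) : is_derive x 1 f d -> 0 < e ->
  exists2 r, 0 < r & forall h, `|h| < r -> `|f (x + h) - f x - d * h| <= e * `|h|.
Proof. by move=> [df <-] e0; exact: (quotient_cvgP f x _).1 df e e0. Qed.

(** By the addition formula only the origin matters, where
    [exp (x + iy) - 1 - x - iy] is expanded with the derivatives of the real
    functions [exp], [cos] and [sin] at 0. *)
Lemma cdiff_cexp z : cdiff cexp z (cexp z).
Proof.
move=> e e0; set E := expR (Re z).
have E0 : 0 < E by exact: expR_gt0.
(* The error terms below add up to [9 e' |k|], to be multiplied by [E]. *)
pose e' := Num.min 1 (e / (E * 9)).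
have e'0 : 0 < e' by rewrite lt_min ltr01 divr_gt0 // mulr_gt0.
have [e'1 e'e] : e' <= 1 /\ e' * (E * 9) <= e.
  split; first by rewrite /e' ge_min lexx.
  by rewrite -ler_pdivlMr ?mulr_gt0 // /e' ge_min lexx orbT.
clearbody e'.
have [r1 r10 h1] := @is_derive_approx (@expR R) 0 1 e' ltac:(by rewrite -{2}(@expR0 R); exact: is_derive_expR) e'0.
have [r2 r20 h2] := @is_derive_approx (@cos R) 0 0 e'
  ltac:(by rewrite -{2}(@oppr0 R) -{2}(@sin0 R); exact: is_derive_cos) e'0.
have [r3 r30 h3] := @is_derive_approx (@sin R) 0 1 e'
  ltac:(by rewrite -{2}(@cos0 R); exact: is_derive_sin) e'0.
exists (Num.min e' (Num.min r1 (Num.min r2 r3))); first by rewrite !lt_min e'0 r10 r20.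
move=> k; rewrite !lt_min => /and4P[k1 kr1 kr2 kr3].
have -> : cexp (z + k) - cexp z - cexp z * k = cexp z * (cexp k - 1 - k).
  by rewrite cexpD; ring.
rewrite normcM normc_cexp -/E.
set N := normc k in k1 kr1 kr2 kr3 *.
have kx := Re_le_normc k; have ky := Im_le_normc k; rewrite -/N in kx ky.
have := h1 _ (le_lt_trans kx kr1); have := h2 _ (le_lt_trans ky kr2).
have := h3 _ (le_lt_trans ky kr3).
rewrite !add0r expR0 cos0 sin0 mul0r !mul1r !subr0.
set x := Re k in kx *; set y := Im k in ky *.
set a := expR x => hs hc ha.
have N1 : N <= 1 by rewrite ltW // (lt_le_trans k1).
have N0 : 0 <= N by exact: normc_ge0.
have a0 : 0 <= a by exact: expR_ge0.
have hx : e' * `|x| <= e' * N by rewrite ler_pM2l.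
have hy : e' * `|y| <= e' * N by rewrite ler_pM2l.
have a1 : `|a - 1| <= 2 * N.
  have -> : a - 1 = (a - 1 - x) + x by ring.
  apply: le_trans (ler_normD _ _) _; have : e' * N <= 1 * N by rewrite ler_wpM2r.
  by clear -ha hx kx; lra.
have a3 : a <= 3 by move: a1; rewrite ler_norml => /andP[_]; clear -N1; lra.
have H1 : `|a * cos y - 1 - x| <= 4 * (e' * N).
  have -> : a * cos y - 1 - x = (a - 1 - x) + a * (cos y - 1) by ring.
  apply: le_trans (ler_normD _ _) _; rewrite normrM (ger0_norm a0).
  have : a * `|cos y - 1| <= 3 * (e' * N) by rewrite ler_pM // (le_trans hc).
  by clear -ha hx; lra.
have H2 : `|a * sin y - y| <= 5 * (e' * N).
  have -> : a * sin y - y = (a - 1) * y + a * (sin y - y) by ring.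
  apply: le_trans (ler_normD _ _) _; rewrite !normrM (ger0_norm a0).
  have : a * `|sin y - y| <= 3 * (e' * N) by rewrite ler_pM // (le_trans hs).
  have : `|a - 1| * `|y| <= 2 * N * e'.
    by rewrite ler_pM // (le_trans ky) // ltW.
  by clear; lra.
have H : normc (cexp k - 1 - k) <= 9 * (e' * N).
  apply: le_trans (normc_le _) _.
  have -> : Re (cexp k - 1 - k) = a * cos y - 1 - x by rewrite /a /x /y; case: (k).
  have -> : Im (cexp k - 1 - k) = a * sin y - y.
    by rewrite /a /x /y; case: (k) => ? ? /=; rewrite oppr0 addr0.
  by move: H1 H2; clear; lra.
apply: le_trans (_ : E * (9 * (e' * N)) <= _); first by rewrite ler_pM2l.
have -> : E * (9 * (e' * N)) = e' * (E * 9) * N by ring.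
by rewrite ler_wpM2r.
Qed.

End Complex.

(** * The mean value property *)

Section MeanValue.
Variable R : realType.
Local Open Scope complex_scope.
Local Notation C := R[i].
Local Notation normc := (@Normc.normc R).
Local Notation Re := (@complex.Re R).
Local Notation Im := (@complex.Im R).
Local Notation mu := (@lebesgue_measure R).
Local Notation twopi := (@pi R *+ 2).
Implicit Types (a z w k : C) (g : C^o -> C^o).

Definition cexpi (t : R) : C := cexp (0 +i* t).

Lemma cexpiE t : cexpi t = cos t +i* sin t.
Proof. by rewrite /cexpi /cexp /= expR0 !mul1r. Qed.

Lemma normc_cexpi t : normc (cexpi t) = 1.
Proof. by rewrite /cexpi normc_cexp expR0. Qed.

Lemma twopi_gt0 : 0 < twopi. Proof. by rewrite pmulrn_lgt0 // pi_gt0. Qed.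

Lemma derivable_circle g a k w : derivable g (a + k * cexp w) 1 ->
  derivable ((fun w => g (a + k * cexp w)) : C^o -> C^o) w 1.
Proof.
move=> dg; apply/derivable1_diffP.
apply: (@differentiable_comp _ _ _ _ (fun w : C^o => a + k * cexp w : C^o) g).
  apply/derivable1_diffP/derivableD; first exact: derivable_cst.
  apply: (@derivableM C C^o (cst k) (@cexp R)); first exact: derivable_cst.
  exact: cdiff_derivable (@cdiff_cexp R w).
exact/derivable1_diffP.
Qed.

(** A version of continuity with real tolerances; it applies to the removable
    singularity of [f z / z], where no derivative is at hand. *)
Definition ccontinuous_at g a := forall e, 0 < e -> exists2 r, 0 < r &
  forall z, normc (z - a) < r -> normc (g z - g a) <= e.

Lemma derivable_ccontinuous g a : derivable g a 1 -> ccontinuous_at g a.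
Proof.
move=> /derivable_cdiff[c dg] e e0; have [r r0 hr] := dg 1 ltr01.
have p0 : 0 < 1 + normc c by rewrite ltr_wpDr // normc_ge0.
exists (Num.min r (e / (1 + normc c))); first by rewrite lt_min r0 divr_gt0.
move=> z; rewrite lt_min ltr_pdivlMr // => /andP[zr ze].
have := hr _ zr; rewrite subrKC mul1r => h.
apply: le_trans (normc_dist_le _ (c * (z - a))) _; rewrite normcM.
by move: h ze; clear; lra.
Qed.

Lemma derivable_Re_circle g a k t : derivable g (a + k * cexpi t) 1 ->
  {for t, continuous (fun t => Re (g (a + k * cexpi t)))}.
Proof.
by move=> /derivable_circle/derivable_cdiff[c /cdiff_frechet2[_ /frechet2_continuous[]]].
Qed.

(** By Goursat's lemma for [w |-> g (a + k exp w)] the mean over the circle of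
    radius [|k| exp s] is the same for all [s <= 0].  The complex factor [k]
    carries both the radius and the starting angle, so that the circle through a
    given point can be started at that point. *)
Theorem circle_mean g a k rho : normc k < rho ->
  (forall z, 0 < normc (z - a) < rho -> derivable g z 1) ->
  ccontinuous_at g a ->
  \int[mu]_(t in `[0, twopi]) Re (g (a + k * cexpi t)) = Re (g a) * twopi.
Proof.
move=> krho dg cg; have [->|k0] := eqVneq k 0.
  rewrite -[X in _ = _ * X]subr0 -itv_integral_cst ?(ltW twopi_gt0) //.
  by apply: eq_Rintegral => t _; rewrite mul0r addr0.
have nk0 : 0 < normc k by rewrite normc_gt0.
pose h w := g (a + k * cexp w).
have dh w : Re w <= 0 -> derivable (h : C^o -> C^o) w 1.
  move=> w0; apply/derivable_circle/dg; rewrite addrC addKr normcM normc_cexp.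
  rewrite mulr_gt0 ?expR_gt0 //=; apply: le_lt_trans krho.
  by rewrite ler_piMr ?normc_ge0 // -expR0 ler_expR.
have ch (s t : R) : s <= 0 -> {for t, continuous (fun t : R => Re (h (s +i* t)))}.
  by move=> s0; have /derivable_cdiff[c /cdiff_frechet2[_ /frechet2_continuous[]]] := dh (s +i* t) s0.
have hper s : h (s +i* twopi) = h (s +i* 0).
  by rewrite /h /cexp /= sin2pi cos2pi sin0 cos0.
suff H (e : R) : 0 < e -> `|\int[mu]_(t in `[0, twopi]) Re (h (0 +i* t)) - Re (g a) * twopi|
    <= e * twopi.
  apply/eqP; rewrite -subr_eq0 -normr_le0; apply/ler_addgt0Pl => e e0; rewrite addr0.
  by have := H _ (divr_gt0 e0 twopi_gt0); rewrite divfK // gt_eqF // twopi_gt0.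
move=> e0; have [r r0 hr] := cg _ e0.
(* With this choice [|k| exp s0 < r] follows from [1 + x <= exp x]. *)
pose s0 := - (normc k / r); have s00 : s0 < 0 by rewrite oppr_lt0 divr_gt0.
have ks0 : normc k * expR s0 < r.
  rewrite /s0 expRN ltr_pdivrMr ?expR_gt0 // -ltr_pdivrMl // mulrC.
  by apply: lt_le_trans (expR_ge1Dx _); rewrite ltrDr.
have := @goursat R (fun s t => Im (h (s +i* t))) (fun s t => Re (h (s +i* t)))
  s0 0 0 twopi s00 twopi_gt0.
rewrite /circulation => G.
have {}G : \int[mu]_(t in `[0, twopi]) Re (h (0 +i* t)) =
           \int[mu]_(t in `[0, twopi]) Re (h (s0 +i* t)).
  apply/eqP; rewrite -subr_eq0 -RintegralB //; first last.
  - by apply: itv_integrable => t _; apply: ch; exact: ltW.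
  - by apply: itv_integrable => t _; exact: ch.
  rewrite -[X in X == _]add0r -[X in _ == X]G.
    apply/eqP; congr (_ + _); rewrite -[LHS](mul0r (0 - s0)) -itv_integral_cst ?ltW //.
    by apply: eq_Rintegral => s _; rewrite hper subrr.
  move=> s t /andP[_ s_le0] _.
  have /derivable_cdiff[c /cdiff_frechet2[h1 h2]] := dh (s +i* t) s_le0.
  by exists (Im c), (Re c), (- Im c).
rewrite G -[X in _ - _ * X]subr0 -[X in _ <= _ * X]subr0.
apply: itv_integral_approx; first exact/ltW/twopi_gt0.
  by move=> t _; apply: ch; exact: ltW.
move=> t _; rewrite -[Re (g a)]/(Re (g a)).
have -> : Re (h (s0 +i* t)) - Re (g a) = Re (h (s0 +i* t) - g a).
  by case: (h _) => ? ?; case: (g a).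
apply: le_trans (Re_le_normc _) _; apply: hr.
by rewrite addrC addKr normcM normc_cexp.
Qed.

End MeanValue.

(** * The Schwarz lemma *)

Section Schwarz.
Variable R : realType.
Local Open Scope complex_scope.
Local Notation C := R[i].
Local Notation normc := (@Normc.normc R).
Local Notation Re := (@complex.Re R).
Local Notation Im := (@complex.Im R).
Local Notation mu := (@lebesgue_measure R).
Local Notation twopi := (@pi R *+ 2).
Implicit Types (a z w k : C) (f g h : C^o -> C^o).

Lemma circle_mean_le g a k rho B : normc k < rho ->
  (forall z, 0 < normc (z - a) < rho -> derivable g z 1) ->
  ccontinuous_at g a ->
  (forall t, Re (g (a + k * cexpi t)) <= B) -> Re (g a) <= B.
Proof.
move=> krho dg cg gB; have [k0|k0] := eqVneq k 0.
  by have := gB 0; rewrite k0 mul0r addr0.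
rewrite -(ler_pM2r (twopi_gt0 R)) -(circle_mean krho dg cg).
rewrite -[X in _ * X]subr0 -itv_integral_cst ?(ltW (twopi_gt0 R)) //.
apply: le_Rintegral => //; apply: itv_integrable => t _.
  apply: derivable_Re_circle; apply: dg.
  by rewrite addrC addKr normcM normc_cexpi mulr1 normc_gt0 k0.
exact: cst_continuous.
Qed.

Lemma continuous_complex_of_pair :
  continuous (@complex_of_pair R : (R * R)%type -> C^o).
Proof.
move=> p; apply/cvgrPdist_le => _/pos_complexP[e e0 ->].
have /cvgrPdist_le/(_ _ (divr_gt0 e0 (ltr0n R 2))) H1 :
  (fun q : R * R => q.1) q @[q --> p] --> p.1 by exact: cvg_fst.
have /cvgrPdist_le/(_ _ (divr_gt0 e0 (ltr0n R 2))) H2 :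
  (fun q : R * R => q.2) q @[q --> p] --> p.2 by exact: cvg_snd.
near=> q; rewrite norm_normc lecR; apply: le_trans (normc_le _) _.
by rewrite [leRHS]splitr /= lerD //; near: q.
Unshelve. all: by end_near. Qed.

Lemma continuous_normc : continuous (normc : C^o -> R).
Proof.
move=> z; apply/(@cvgrPdist_le _ _ _ (nbhs (z : C^o)) (nbhs_filter (z : C^o))) => e e0.
exists e%:C => /=; first by rewrite ltcR.
move=> w /=; rewrite /ball_ /= norm_normc ltcR => /ltW; apply: le_trans.
rewrite ler_norml lerNl opprB !lerBlDl normc_dist_le andbT.
by rewrite normc_distC normc_dist_le.
Qed.

Lemma ccontinuous_continuous g a : ccontinuous_at g a -> {for a, continuous g}.
Proof.
move=> cg; apply/(@cvgrPdist_le _ _ _ (nbhs (a : C^o)) (nbhs_filter (a : C^o))) => _/pos_complexP[e e0 ->].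
have [r r0 hr] := cg _ e0; exists r%:C => /=; first by rewrite ltcR.
move=> z /=; rewrite /ball_ /= !norm_normc ltcR lecR normc_distC => /hr.
by rewrite normc_distC.
Qed.

Lemma compact_disc (r : R) : compact [set p : R * R | normc (complex_of_pair p) <= r].
Proof.
have cn : continuous (fun p : R * R => normc (complex_of_pair p)).
  move=> p; apply: (@continuous_comp _ _ _ (@complex_of_pair R : R * R -> C^o)).
    exact: continuous_complex_of_pair.
  exact: continuous_normc.
rewrite (_ : [set p | _] = (`[- r, r] `*` `[- r, r]) `&`
    ((fun p : R * R => normc (complex_of_pair p)) @^-1` [set x | x <= r])).
  apply: compact_closedI.
    by apply: compact_setX; exact: segment_compact.
  by apply: preimage_closed; [move=> p _; exact: cn|exact: closed_le].
apply/seteqP; split => [p /= h|p [_ //]]; split => //.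
rewrite /= !in_itv /= -!ler_norml.
by rewrite (le_trans (Re_le_normc (complex_of_pair p)) h)
  (le_trans (Im_le_normc (complex_of_pair p)) h).
Qed.

(** Strict subharmonicity of [|h|^2 + e |z|^2] across a circle, obtained from the
    mean value property of the single function [g] below: pointwise on the
    circle [Re g <= (|h a|^2 + B - e |a|^2 - e |k|^2) / 2], while
    [Re (g a) = |h a|^2].  The term [e |z|^2] makes the inequality strict, which
    spares the discussion of when a maximum is attained on a whole circle. *)
Lemma max_modulus_circle h a k rho e B : normc k < rho -> k != 0 -> 0 < e ->
  (forall z, 0 < normc (z - a) < rho -> derivable h z 1) ->
  ccontinuous_at h a ->
  (forall t, normc (h (a + k * cexpi t)) ^+ 2 +
     e * normc (a + k * cexpi t) ^+ 2 <= B) ->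
  normc (h a) ^+ 2 + e * normc a ^+ 2 < B.
Proof.
move=> krho k0 e0 dh ch hB.
pose g z : C^o := (h a)^* * h z + e%:C * (a^* * (z - a)).
have ReMJ (u v : C) : Re (u^* * v) = Re u * Re v + Im u * Im v.
  by case: u v => [? ?] [? ?] /=; ring.
have ReM (x : R) (v : C) : Re (x%:C * v) = x * Re v by case: v => ? ? /=; ring.
have ReD (u v : C) : Re (u + v) = Re u + Re v by case: u; case: v.
have ImD (u v : C) : Im (u + v) = Im u + Im v by case: u; case: v.
have Rega : Re (g a) = normc (h a) ^+ 2.
  by rewrite /g subrr !mulr0 addr0 ReMJ normc2E; ring.
have nk : 0 < normc k by rewrite normc_gt0.
have : Re (g a) <= (normc (h a) ^+ 2 + B - e * normc a ^+ 2 - e * normc k ^+ 2) / 2.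
  apply: (circle_mean_le krho).
  - move=> z /dh dhz; rewrite /g.
    have dza : derivable ((fun z => z - a) : C^o -> C^o) z 1.
      apply: (@cdiff_derivable R _ z 1) => d d0; exists 1 => // k' _.
      have -> : z + k' - a - (z - a) - 1 * k' = 0 by ring.
      by rewrite Normc.normc0 mulr_ge0 ?normc_ge0 // ltW.
    exact: (@derivableD C C^o C^o _ _ z 1 (@derivableZ C C^o C^o h (h a)^* z 1 dhz)
      (@derivableZ C C^o C^o _ e%:C z 1 (@derivableZ C C^o C^o _ a^* z 1 dza))).
  - move=> d d0; have d2 : 0 < d / 2 by rewrite divr_gt0.
    have n1 : 0 < normc (h a) + 1 by rewrite ltr_wpDl // normc_ge0.
    have n2 : 0 < e * normc a + 1.
      by rewrite ltr_wpDl // mulr_ge0 ?normc_ge0 // ltW.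
    have [r r0 hr] := ch _ (divr_gt0 d2 n1).
    exists (Num.min r (d / 2 / (e * normc a + 1))).
      by rewrite lt_min r0 divr_gt0.
    move=> z; rewrite lt_min => /andP[/hr h1 h2].
    have -> : g z - g a = (h a)^* * (h z - h a) + e%:C * (a^* * (z - a)).
      by rewrite /g subrr; ring.
    apply: le_trans (normcD _ _) _; rewrite !normcM !normc_conj normc_real.
    rewrite (gtr0_norm e0) [leRHS]splitr lerD //.
      move: h1; rewrite ler_pdivlMr // mulrC; apply: le_trans.
      by rewrite ler_wpM2r ?normc_ge0 // lerDl.
    move: h2 => /ltW; rewrite ler_pdivlMr // mulrC; apply: le_trans.
    by rewrite mulrA ler_wpM2r ?normc_ge0 // lerDl.
  - move=> t; move: (hB t); set z := a + k * cexpi t => hBz.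
    have nz : normc z ^+ 2 = normc a ^+ 2 + normc k ^+ 2 + 2 * Re (a^* * (z - a)).
      have -> : normc k ^+ 2 = normc (z - a) ^+ 2.
        by rewrite /z addrC addKr normcM normc_cexpi mulr1.
      by rewrite !normc2E ReMJ; case: (z) => ? ?; case: (a) => ? ? /=; ring.
    have hz : 2 * Re ((h a)^* * h z) <= normc (h a) ^+ 2 + normc (h z) ^+ 2.
      rewrite ReMJ !normc2E; set x1 := Re (h a); set x2 := Im (h a).
      set y1 := Re _; set y2 := Im _; clear.
      have := sqr_ge0 (x1 - y1); have := sqr_ge0 (x2 - y2); lra.
    rewrite /g ReD ReM ler_pdivlMr //; move: hBz; rewrite nz.
    by move: hz; clear; lra.
rewrite Rega.
have : 0 < e * normc k ^+ 2 by rewrite mulr_gt0 // exprn_gt0.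
by clear; lra.
Qed.

(** The maximum principle for [f z / z] on discs of radius [r < 1]: a maximum point
    of [|f z / z|^2 + e |z|^2] cannot be interior, hence the value is at most
    [1 / r^2 + e]; then [e] tends to 0 and [r] to 1. *)
Theorem schwarz_lemma f : (forall z, normc z < 1 -> derivable f z 1) ->
  f 0 = 0 -> (forall z, normc z < 1 -> normc (f z) <= 1) ->
  forall z, normc z < 1 -> normc (f z) <= normc z.
Proof.
move=> df f0 fB z1 z11; have [->|z10] := eqVneq z1 0.
  by rewrite f0 Normc.normc0.
have nz1 : 0 < normc z1 by rewrite normc_gt0.
have [c fc] : exists c, cdiff f 0 c.
  by apply: derivable_cdiff; apply: df; rewrite Normc.normc0.
(* The value at 0 is the derivative of [f], which makes [h] continuous there. *)
pose h : C^o -> C^o := fun z => if z == 0 then c else f z / z.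
have hE z : z != 0 -> h z = f z / z by move=> /negPf z0; rewrite /h z0.
have dh z : z != 0 -> normc z < 1 -> derivable h z 1.
  move=> z0 zlt1; apply: (@near_eq_derivable _ _ _ (fun w : C^o => f w * w^-1)).
    exists `|z| => /=; first by rewrite normr_gt0.
    move=> w /= zw; rewrite hE //; apply/eqP => w0; move: zw.
    by rewrite w0 subr0 ltxx.
  have dV := @derivableV C C^o (fun w : C^o => (w : C)) z 1 z0 (@derivable_id C C^o z 1).
  exact: (@derivableM C C^o f (fun w => w^-1) z 1 (df _ zlt1) dV).
have ch0 : ccontinuous_at h 0.
  move=> e e0; have [r r0 hr] := fc _ e0; exists r => // z; rewrite subr0 => zr.
  rewrite {2}/h eqxx; have [->|z0] := eqVneq z 0.
    by rewrite /h eqxx subrr Normc.normc0 ltW.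
  rewrite hE // -(ler_pM2r (_ : 0 < normc z)) ?normc_gt0 // -normcM.
  by rewrite mulrBl divfK //; have := hr _ zr; rewrite add0r f0 subr0.
have ch z : normc z < 1 -> ccontinuous_at h z.
  have [-> _|z0 zlt1] := eqVneq z 0; first exact: ch0.
  exact/derivable_ccontinuous/dh.
suff H r e : normc z1 < r < 1 -> 0 < e -> normc (h z1) ^+ 2 <= 1 / r ^+ 2 + e.
  have {}H r : normc z1 < r < 1 -> normc (h z1) * r <= 1.
    move=> hr; have r0 : 0 < r by case/andP: hr => /(lt_trans nz1).
    have : normc (h z1) ^+ 2 <= 1 / r ^+ 2.
      by apply/ler_addgt0Pl => e e0; rewrite addrC; exact: H.
    rewrite ler_pdivlMr ?exprn_gt0 // -exprMn => hh.
    by rewrite -(@ler_pXn2r _ 2) ?nnegrE ?expr1n // mulr_ge0 ?normc_ge0 // ltW.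
  have : normc (h z1) <= 1.
    rewrite leNgt; apply/negP => h1.
    (* A radius strictly between [m] and 1 is admissible and contradicts the
       bound [|h z1| * r <= 1]. *)
    pose m := Num.max (normc z1) (normc (h z1))^-1.
    have h0 : 0 < normc (h z1) by exact: lt_trans h1.
    have m1 : m < 1 by rewrite gt_max z11 invf_lt1.
    have /H : normc z1 < (m + 1) / 2 < 1.
      have : normc z1 <= m by rewrite le_max lexx.
      by move: m1; clear; move=> ? ?; apply/andP; split; lra.
    rewrite -ler_pdivlMl // mulr1; apply/negP; rewrite -ltNge.
    have : (normc (h z1))^-1 <= m by rewrite le_max lexx orbT.
    by move: m1; clear; lra.
  by rewrite hE // normcM Normc.normcV ler_pdivrMr // mul1r.
move=> /andP[zr r1] e0.
have r0 : 0 < r by exact: lt_trans zr.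
pose Phi (p : R * R) : R := normc (h (complex_of_pair p)) ^+ 2 +
  e * normc (complex_of_pair p) ^+ 2.
have cPhi : {within [set p : R * R | normc (complex_of_pair p) <= r], continuous Phi}.
  apply/continuous_in_subspaceT => p; rewrite inE /= => pr.
  have cn : {for p, continuous (fun q : R * R => normc (complex_of_pair q))}.
    apply: (@continuous_comp _ _ _ (@complex_of_pair R : R * R -> C^o)).
      exact: continuous_complex_of_pair.
    exact: continuous_normc.
  have chp : {for p, continuous (fun q : R * R => normc (h (complex_of_pair q)))}.
    apply: (@continuous_comp _ _ _ (fun q : R * R => h (complex_of_pair q))).
      apply: (@continuous_comp _ _ _ (@complex_of_pair R : R * R -> C^o)).
        exact: continuous_complex_of_pair.
      by apply: ccontinuous_continuous; apply: ch; exact: le_lt_trans r1.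
    exact: continuous_normc.
  apply: cvgD; first by apply: cvgM.
  by apply: cvgM; [exact: cvg_cst|apply: cvgM].
have ne : [set p : R * R | normc (complex_of_pair p) <= r] !=set0.
  by exists (Re z1, Im z1); rewrite /complex_of_pair /=; case: (z1) zr => ? ? /= /ltW.
have [p0] := compact_EVT_max ne (@compact_disc r) cPhi.
rewrite inE => p0r pmax.
have {}p0r : normc (complex_of_pair p0) <= r by [].
have zmax z : normc z <= r -> normc (h z) ^+ 2 + e * normc z ^+ 2 <= Phi p0.
  case: z => x y xyr; apply: (pmax (x, y)); rewrite inE //.
move: p0r pmax zmax; rewrite /Phi; set z0 := complex_of_pair p0 => z0r _ zmax.
have h1 : normc (h z1) ^+ 2 <= normc (h z1) ^+ 2 + e * normc z1 ^+ 2.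
  by rewrite lerDl mulr_ge0 ?sqr_ge0 // ltW.
apply: (le_trans h1); apply: le_trans (zmax _ (ltW zr)) _.
move: z0r; rewrite le_eqVlt => /predU1P[z0r|z0r].
  have z00 : z0 != 0 by rewrite -normc_gt0 z0r.
  rewrite hE // normcM Normc.normcV exprMn exprVn z0r lerD //.
    rewrite ler_pM2r ?invr_gt0 ?exprn_gt0 //.
    by rewrite expr_le1 ?normc_ge0 // fB // z0r.
  by rewrite ler_piMr ?(ltW e0) // expr_le1 // ltW.
exfalso.
(* The punctured disc of radius [rho] around [z0] must avoid 0, where [h] is not
   known to be differentiable. *)
pose rho := if z0 == 0 then r else Num.min (r - normc z0) (normc z0).
have rho0 : 0 < rho.
  rewrite /rho; case: ifP => // /negbT z00; rewrite lt_min subr_gt0 z0r.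
  by rewrite normc_gt0.
have rhor z : normc (z - z0) < rho -> normc z < r.
  rewrite /rho; case: ifP => [/eqP ->|_]; first by rewrite subr0.
  rewrite lt_min ltrBrDl => /andP[H _]; apply: le_lt_trans H.
  exact: normc_dist_le.
have dhz z : 0 < normc (z - z0) < rho -> derivable h z 1.
  move=> /andP[h2 h3]; apply: dh; last by apply: lt_trans r1; exact: rhor.
  apply/eqP => zz; move: h2 h3; rewrite zz sub0r -(sub0r z0) normc_distC subr0.
  rewrite normc_gt0 /rho => /negPf ->.
  by rewrite lt_min ltxx andbF.
have nk : normc (rho / 2)%:C < rho.
  by rewrite normc_real gtr0_norm ?divr_gt0 // ltr_pdivrMr // ltr_pMr // ltr1n.
have k0 : (rho / 2)%:C != 0.
  by rewrite -normc_gt0 normc_real normr_gt0 gt_eqF // divr_gt0.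
have := max_modulus_circle nk k0 e0 dhz (ch _ (lt_trans z0r r1)) (B := Phi p0).
rewrite /Phi -/z0 ltxx => /(_ _)/negP; apply => // t.
apply: zmax; apply/ltW/rhor.
by rewrite addrC addKr normcM normc_cexpi mulr1.
Qed.

End Schwarz.

(** * Lebesgue measure of the plane *)

Section PlanarMeasure.
Variable R : realType.
Local Open Scope complex_scope.
Local Notation normc := (@Normc.normc R).
Local Notation mu := (@lebesgue_measure R).
Local Notation area := (mu \x mu)%E.
Local Notation mR := (measurableTypeR R).
Implicit Types (A : set (mR * mR)%type) (p q : (mR * mR)%type).

(** Every point of [A] lies in a box with rational ends contained in [A], and there
    are countably many such boxes. *)
Lemma measurable_open_plane A :
  (forall p, A p -> exists2 e : R, 0 < e &
     forall q, `|q.1 - p.1| < e -> `|q.2 - p.2| < e -> A q) ->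
  measurable A.
Proof.
move=> oA.
pose box (i : (rat * rat) * (rat * rat)) : set (mR * mR) :=
  `](ratr i.1.1 : R), ratr i.1.2[%classic `*` `](ratr i.2.1 : R), ratr i.2.2[%classic.
pose F i := if `[< box i `<=` A >] then box i else set0.
have -> : A = \bigcup_i F i.
  apply/seteqP; split => [p Ap|p [i _]]; last first.
    by rewrite /F; case: ifP => // /asboolP; apply.
  have [e e0 pe] := oA _ Ap.
  have q1 (x : R) : exists q : rat, x - e < ratr q < x.
    have [q] := @rat_in_itvoo R (x - e) x ltac:(by rewrite ltrBlDr ltrDl).
    by rewrite in_itv /=; exists q.
  have q2 (x : R) : exists q : rat, x < ratr q < x + e.
    have [q] := @rat_in_itvoo R x (x + e) ltac:(by rewrite ltrDl).
    by rewrite in_itv /=; exists q.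
  have [a /andP[a1 a2]] := q1 p.1; have [b /andP[b1 b2]] := q2 p.1.
  have [c /andP[c1 c2]] := q1 p.2; have [d /andP[d1 d2]] := q2 p.2.
  exists ((a, b), (c, d)) => //; rewrite /F; case: ifPn => [_|/asboolP[]].
    by split; rewrite /= in_itv /= ?a2 ?b1 ?c2 ?d1.
  move=> q [/=]; rewrite !in_itv /= => /andP[x1 x2] /andP[y1 y2].
  by apply: pe; rewrite ltr_norml; apply/andP; split;
    [move: a1 x1|move: b2 x2|move: c1 y1|move: d2 y2]; clear; lra.
apply: countable_bigcupT_measurable; first exact: countableP.
move=> i; rewrite /F; case: ifP => // _; exact: measurableX.
Qed.

Lemma measurable_open_complex A :
  (forall p, A p -> exists2 e : R, 0 < e &
     forall q, normc (complex_of_pair q - complex_of_pair p) < e -> A q) ->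
  measurable A.
Proof.
move=> oA; apply: measurable_open_plane => p /oA[e e0 pe].
exists (e / 2) => [|q h1 h2]; first by rewrite divr_gt0.
apply: pe; rewrite [ltRHS]splitr; apply: le_lt_trans (ltrD h1 h2).
exact: normc_le.
Qed.

(** Both sides are measures that agree on half-open intervals. *)
Lemma lebesgue_measure_affine (r b : R) (A : set mR) : 0 < r -> measurable A ->
  mu A = (r%:E * mu ((fun y => (r * y + b)%R) @^-1` A))%E.
Proof.
move=> r0 mA; pose G (y : mR) : mR := r * y + b.
have mG : measurable_fun setT G.
  by apply: measurable_funD => //; apply: measurable_funM.
pose G' : {mfun mR >-> mR} := HB.pack G (isMeasurableFun.Build _ _ _ _ G mG).
pose r' : {nonneg R} := NngNum (ltW r0).
apply: (@lebesgue_measure_unique R (mscale r' (pushforward mu G'))) mA.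
move=> X /ocitvP[->|[[x y] /= xy ->]]; first by rewrite !measure0.
change (mu `]x, y] = r%:E * mu (G @^-1` `]x, y]))%E.
rewrite (_ : G @^-1` _ = `](x - b) / r, (y - b) / r]%classic); last first.
  apply/seteqP; split => z; rewrite /= !in_itv /= /G;
  by rewrite ltr_pdivrMr // ler_pdivlMr // ltrBlDr lerBrDr mulrC.
rewrite !lebesgue_measure_itv /= !lte_fin xy ltr_pM2r ?invr_gt0 // ltrD2r xy.
by rewrite -!EFinB -EFinM; congr EFin; field; rewrite gt_eqF.
Qed.

(** The measure defined by integrating over horizontal sections agrees with the
    product measure on rectangles, hence everywhere. *)
Lemma area_ysection A : measurable A -> area A = (\int[mu]_y mu (ysection A y))%E.
Proof.
move=> mA; apply: (@product_measure_unique _ _ _ _ _ mu mu (mu \x^ mu)%E) => //.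
by move=> B C mB mC /=; rewrite product_measure2E.
Qed.

Lemma measurable_pair_preimage (f g : mR * mR -> mR) A : measurable_fun setT f ->
  measurable_fun setT g -> measurable A -> measurable [set p | A (f p, g p)].
Proof.
move=> mf mg mA; rewrite -[X in measurable X]setTI.
exact: (measurable_fun_pair mf mg measurableT mA).
Qed.

Lemma measurable_vertical (r b : R) A : measurable A ->
  measurable [set p | A (p.1, r * p.2 + b * p.1)].
Proof.
apply: measurable_pair_preimage; first exact: measurable_fst.
by apply: measurable_funD; apply: measurable_funM.
Qed.

Lemma measurable_horizontal (r b : R) A : measurable A ->
  measurable [set p | A (r * p.1 + b * p.2, p.2)].
Proof.
apply: measurable_pair_preimage; last exact: measurable_snd.
by apply: measurable_funD; apply: measurable_funM.
Qed.

(** On each vertical line the map is affine in one variable.  The case [b = 0] is a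
    dilation, the case [r = 1] a shear. *)
Lemma area_vertical_affine (r b : R) A : 0 < r -> measurable A ->
  area A = (r%:E * area [set p | A (p.1, (r * p.2 + b * p.1)%R)])%E.
Proof.
move=> r0 mA; pose B := [set p | A (p.1, r * p.2 + b * p.1)].
have mB : measurable B by exact: measurable_vertical.
rewrite {1}/product_measure1.
under eq_integral => x _.
  rewrite /= (@lebesgue_measure_affine r (b * x) (xsection A x)) //; last first.
    exact: measurable_xsection.
  rewrite (_ : _ @^-1` _ = xsection B x); last first.
    by apply/seteqP; split => y; rewrite /xsection /= !inE.
  over.
rewrite ge0_integralZl_EFin //; last exact: ltW.
exact: measurable_fun_xsection.
Qed.

Lemma area_horizontal_affine (r b : R) A : 0 < r -> measurable A ->
  area A = (r%:E * area [set p | A ((r * p.1 + b * p.2)%R, p.2)])%E.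
Proof.
move=> r0 mA; pose B := [set p | A (r * p.1 + b * p.2, p.2)].
have mB : measurable B by exact: measurable_horizontal.
rewrite !area_ysection //.
under eq_integral => x _.
  rewrite /= (@lebesgue_measure_affine r (b * x) (ysection A x)) //; last first.
    exact: measurable_ysection.
  rewrite (_ : _ @^-1` _ = ysection B x); last first.
    by apply/seteqP; split => y; rewrite /ysection /= !inE.
  over.
rewrite ge0_integralZl_EFin //; last exact: ltW.
exact: measurable_fun_ysection.
Qed.

Definition rotation (c s : R) p : (mR * mR)%type :=
  (c * p.1 - s * p.2, s * p.1 + c * p.2).

Lemma measurable_rotation c s : measurable_fun setT (rotation c s).
Proof.
by apply: measurable_fun_pair; [apply: measurable_funB|apply: measurable_funD];
  apply: measurable_funM.
Qed.

Lemma measurable_rotation_preimage c s A : measurable A ->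
  measurable (rotation c s @^-1` A).
Proof. by move=> mA; rewrite -[_ @^-1` _]setTI; exact: measurable_rotation. Qed.

(** A rotation is a product of three shears, the horizontal ones with coefficient
    [(c - 1) / s]. *)
Lemma area_rotation_neq0 (c s : R) A : c ^+ 2 + s ^+ 2 = 1 -> s != 0 ->
  measurable A -> area (rotation c s @^-1` A) = area A.
Proof.
move=> cs1 s0 mA; pose a := (c - 1) / s.
rewrite [in RHS](area_horizontal_affine a ltr01 mA) mul1e.
set B := [set p | _].
have mB : measurable B by exact: measurable_horizontal.
rewrite [in RHS](area_vertical_affine s ltr01 mB) mul1e.
set B' := [set p | _].
have mB' : measurable B' by exact: measurable_vertical.
rewrite [in RHS](area_horizontal_affine a ltr01 mB') mul1e.
congr (area _); apply/funext => p; rewrite /B' /B /rotation /=; congr (A (_, _)).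
  have -> : c * p.1 - s * p.2 = c * p.1 + (c ^+ 2 - 1) / s * p.2.
    by rewrite -cs1; field.
  by rewrite /a; field.
by rewrite /a; field.
Qed.

(** Only [s = 0] is left, where the rotation is the identity or the square of a
    quarter turn. *)
Lemma area_rotation (c s : R) A : c ^+ 2 + s ^+ 2 = 1 ->
  measurable A -> area (rotation c s @^-1` A) = area A.
Proof.
move=> cs1 mA; have [s0|s0] := eqVneq s 0; last exact: area_rotation_neq0.
have cs01 : (0 : R) ^+ 2 + 1 ^+ 2 = 1 by rewrite expr0n expr1n add0r.
move: cs1; rewrite s0 expr0n /= addr0 => /eqP; rewrite sqrf_eq1 => /orP[]/eqP ->.
  congr (area _); apply/funext => -[x y]; rewrite /rotation /=; congr (A (_, _)); ring.
rewrite -[RHS](area_rotation_neq0 cs01 (oner_neq0 R) mA).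
rewrite -[RHS](area_rotation_neq0 cs01 (oner_neq0 R)); last exact: measurable_rotation_preimage.
congr (area _); apply/funext => -[x y]; rewrite /rotation /=; congr (A (_, _)); ring.
Qed.

Definition disc (r : R) : set (mR * mR)%type := [set p | normc (complex_of_pair p) < r].

Lemma disc_near (r : R) p : disc r p -> exists2 e : R, 0 < e &
  forall q, normc (complex_of_pair q - complex_of_pair p) < e -> disc r q.
Proof.
move=> pr; exists (r - normc (complex_of_pair p)); first by rewrite subr_gt0.
by move=> q; rewrite ltrBrDl; apply: le_lt_trans; exact: normc_dist_le.
Qed.

Lemma measurable_disc r : measurable (disc r).
Proof. by apply: measurable_open_complex => p; exact: disc_near. Qed.

Lemma area_disc r : 0 < r -> area (disc r) = ((r ^+ 2)%:E * area (disc 1))%E.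
Proof.
move=> r0; have md := measurable_disc r.
rewrite (area_vertical_affine 0 r0 md); set B := [set p | _].
have mB : measurable B by exact: measurable_vertical.
rewrite (area_horizontal_affine 0 r0 mB) muleA -EFinM -expr2; congr (_ * area _)%E.
apply/seteqP; split => p; rewrite /B /disc /= !mul0r !addr0 => H.
  move: H; have -> : (r * p.1) ^+ 2 + (r * p.2) ^+ 2 = r ^+ 2 * (p.1 ^+ 2 + p.2 ^+ 2).
    by ring.
  by rewrite sqrtrM ?sqr_ge0 // sqrtr_sqr gtr0_norm // gtr_pMr.
have -> : (r * p.1) ^+ 2 + (r * p.2) ^+ 2 = r ^+ 2 * (p.1 ^+ 2 + p.2 ^+ 2) by ring.
by rewrite sqrtrM ?sqr_ge0 // sqrtr_sqr gtr0_norm // gtr_pMr.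
Qed.

Lemma area_unit_disc_le : (area (disc 1) <= 4%:E)%E.
Proof.
apply: (@le_trans _ _ (area (`[(-1 : R), 1] `*` `[(-1 : R), 1]))).
  apply: le_measure; rewrite ?inE //; [exact: measurable_disc|exact: measurableX|].
  move=> p; rewrite /disc /= !in_itv /= -!ler_norml => /ltW h.
  by split; [exact: le_trans (Re_le_normc (complex_of_pair p)) h
            |exact: le_trans (Im_le_normc (complex_of_pair p)) h].
rewrite product_measure1E //= !lebesgue_measure_itv /= lte_fin.
have -> : (-1 : R) < 1 by lra.
by rewrite -EFinD -EFinM lee_fin; lra.
Qed.

Lemma area_annulus_le (d : R) : 0 < d ->
  (area (disc 1 `\` disc (1 - d)) <= (8 * d)%:E)%E.
Proof.
move=> d0; have m1 := measurable_disc 1; have md := measurable_disc (1 - d).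
have f1 : area (disc 1) \is a fin_num.
  by rewrite ge0_fin_numE // (le_lt_trans area_unit_disc_le) // ltry.
have [d1|d1] := leP 1 d.
  apply: (@le_trans _ _ (area (disc 1))).
    by apply: le_measure; rewrite ?inE //; exact: measurableD.
  by apply: (le_trans area_unit_disc_le); rewrite lee_fin; lra.
rewrite measureD //; last by rewrite -ge0_fin_numE.
rewrite (_ : disc 1 `&` disc (1 - d) = disc (1 - d)); last first.
  apply/setIidPr => p; rewrite /disc /= => /lt_trans; apply.
  by rewrite ltrBlDr ltrDl.
rewrite /= (area_disc (r := 1 - d)) ?subr_gt0 // -(fineK f1) -EFinM -EFinB lee_fin.
have : fine (area (disc 1)) <= 4 by rewrite -lee_fin fineK // area_unit_disc_le.
have : 0 <= fine (area (disc 1)) by rewrite fine_ge0.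
set x := fine _ => x0 x4.
have -> : x - (1 - d) ^+ 2 * x = (2 - d) * d * x by ring.
rewrite -mulrA [leRHS](_ : _ = 2 * (d * 4)); last by ring.
by apply: ler_pM; rewrite ?mulr_ge0 ?subr_ge0 ?ler_pM2l //; lra.
Qed.

End PlanarMeasure.

(** * The area where f is close to 1 *)

Section AreaEstimate.
Variable R : realType.
Local Open Scope complex_scope.
Local Notation C := R[i].
Local Notation normc := (@Normc.normc R).
Local Notation Re := (@complex.Re R).
Local Notation Im := (@complex.Im R).
Local Notation mu := (@lebesgue_measure R).
Local Notation area := (mu \x mu)%E.
Local Notation mR := (measurableTypeR R).
Local Notation twopi := (@pi R *+ 2).

Definition visits (A : set (mR * mR)%type) : set (mR * (mR * mR))%type :=
  [set w | 0 <= w.1 <= twopi /\ A (rotation (cos w.1) (sin w.1) w.2)].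

Lemma measurable_visits A : measurable A -> measurable (visits A).
Proof.
move=> mA; rewrite (_ : visits A = (fst @^-1` `[0, twopi]) `&`
    ((fun w => rotation (cos w.1) (sin w.1) w.2) @^-1` A)); last first.
  by apply/seteqP; split => w [h1 h2]; split => //; move: h1; rewrite /= in_itv.
apply: measurableI; first by rewrite -[X in measurable X]setTI; exact: measurable_fst.
have c1 : measurable_fun setT (fun w : mR * (mR * mR) => cos w.1 : mR).
  have mcos : measurable_fun setT (@cos R : mR -> mR).
    by apply: continuous_measurable_fun; exact: continuous_cos.
  exact: (measurableT_comp mcos).
have s1 : measurable_fun setT (fun w : mR * (mR * mR) => sin w.1 : mR).
  have msin : measurable_fun setT (@sin R : mR -> mR).
    by apply: continuous_measurable_fun; exact: continuous_sin.
  exact: (measurableT_comp msin).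
have x1 : measurable_fun setT (fun w : mR * (mR * mR) => w.2.1 : mR).
  exact: (measurableT_comp measurable_fst).
have y1 : measurable_fun setT (fun w : mR * (mR * mR) => w.2.2 : mR).
  exact: (measurableT_comp measurable_snd).
suff m : measurable_fun setT
    (fun w : mR * (mR * mR) => rotation (cos w.1) (sin w.1) w.2 : mR * mR).
  by rewrite -[X in measurable X]setTI; exact: m.
by apply: measurable_fun_pair; [apply: measurable_funB|apply: measurable_funD];
  apply: measurable_funM.
Qed.

Lemma Re_inv (w : C) : Re w^-1 = Re w / normc w ^+ 2.
Proof. by rewrite normc2E; case: w. Qed.

(** The disc [|w| <= 2 d] meets the half-plane [Re w >= d] only where
    [Re (1 / w) = Re w / |w|^2] is at least [d / (2 d)^2]. *)
Lemma Re_inv_ge (w : C) (d : R) : 0 < d -> d <= Re w -> normc w <= 2 * d ->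
  (4 * d)^-1 <= Re w^-1.
Proof.
move=> d0 dw w2d; have w0 : 0 < Re w by exact: lt_le_trans dw.
have n0 : 0 < normc w by rewrite (lt_le_trans w0) // (le_trans (ler_norm _)) // Re_le_normc.
rewrite Re_inv ler_pdivlMr ?exprn_gt0 // ler_pdivrMl ?mulr_gt0 //.
apply: (@le_trans _ _ ((2 * d) ^+ 2)).
  by rewrite lerXn2r // nnegrE ?normc_ge0 // mulr_ge0 // ltW.
have : d * d <= d * Re w by rewrite ler_pM2l.
by lra.
Qed.

Section NearOne.
Variable f : C^o -> C^o.
Hypothesis df : forall z, normc z < 1 -> derivable f z 1.
Hypothesis f0 : f 0 = 0.
Hypothesis f1 : forall z, normc z < 1 -> normc (f z) <= 1.

Let Re_f z : normc z < 1 -> Re (f z) <= 1.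
Proof.
by move=> /f1; apply: le_trans; rewrite (le_trans (ler_norm _)) // Re_le_normc.
Qed.

Definition near_one (d : R) : set (mR * mR)%type :=
  [set p | normc (complex_of_pair p) < 1 /\ normc (1 - f (complex_of_pair p)) < d].

Lemma measurable_near_one d : measurable (near_one d).
Proof.
apply: measurable_open_complex => p [p1 pd].
have e0 : 0 < (d - normc (1 - f (complex_of_pair p))) / 2.
  by rewrite divr_gt0 // subr_gt0.
have [r r0 hr] := derivable_ccontinuous (df p1) e0.
have [s s0 hs] := disc_near p1.
exists (Num.min r s); first by rewrite lt_min r0.
move=> q; rewrite lt_min => /andP[/hr h /hs q1]; split => //.
apply: le_lt_trans (normc_dist_le _ (1 - f (complex_of_pair p))) _.
have -> : 1 - f (complex_of_pair q) - (1 - f (complex_of_pair p)) =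
  f (complex_of_pair p) - f (complex_of_pair q) by ring.
by rewrite [normc (f _ - f _)]normc_distC; move: h pd; lra.
Qed.

Lemma near_one_annulus d : near_one d `<=` disc 1 `\` disc (1 - d).
Proof.
move=> p [p1 pd]; split => //; apply/negP; rewrite -leNgt.
have := schwarz_lemma df f0 f1 p1.
have := normc_dist_le 1 (f (complex_of_pair p)); rewrite Normc.normc1.
move=> h1 h2; change (1 - d <= normc (complex_of_pair p)).
move: h1 h2 pd; lra.
Qed.

Lemma derivable_inv_sub (d : R) z : 0 < d -> normc z < 1 ->
  derivable ((fun z => ((1 + d)%:C - f z)^-1) : C^o -> C^o) z 1.
Proof.
move=> d0 z1; apply: (@derivableV C C^o (fun z => (1 + d)%:C - f z)).
  apply/eqP => H; have := Re_f z1; have : Re ((1 + d)%:C - f z) = 0 by rewrite H.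
  by case: (f z) => a b /=; move: d0; lra.
exact: (@derivableB C C^o C^o _ _ z 1 (@derivable_cst C C^o C^o (1 + d)%:C z 1) (df z1)).
Qed.

(** Chebyshev's inequality for [Re (1 / (1 + d - f))] on the circle through [p],
    whose mean is at most 1. *)
Lemma circle_near_one (d : R) p : 0 < d -> disc 1 p ->
  (mu (ysection (visits (near_one d)) p) <= (4 * d * twopi)%:E)%E.
Proof.
move=> d0 p1; set S := ysection _ _.
have SE t : S t <-> 0 <= t <= twopi /\ near_one d (rotation (cos t) (sin t) p).
  by rewrite /S /ysection /= inE.
have mS : measurable S.
  by apply: measurable_ysection; apply: measurable_visits; exact: measurable_near_one.
pose z := complex_of_pair p.
have z1 : normc z < 1 by [].
have rotE t : complex_of_pair (rotation (cos t) (sin t) p) = z * cexpi t.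
  rewrite cexpiE /complex_of_pair /rotation /z /complex_of_pair /=.
  by apply/eqP; rewrite eq_complex /=; apply/andP; split; apply/eqP; ring.
pose g (w : C^o) : C^o := ((1 + d)%:C - f w)^-1.
have zt t : normc (0 + z * cexpi t) < 1 by rewrite add0r normcM normc_cexpi mulr1.
have mean : \int[mu]_(t in `[0, twopi]) Re (g (0 + z * cexpi t)) <= twopi.
  rewrite (@circle_mean R g 0 z 1 z1).
  - have -> : Re (g 0) = (1 + d)^-1.
      rewrite /g f0 subr0 Re_inv normc_real real_normK ?num_real //=.
      by field; rewrite gt_eqF //; lra.
    rewrite ler_piMl ?(ltW (twopi_gt0 R)) // invf_le1; lra.
  - by move=> w; rewrite subr0 => /andP[_ w1]; exact: derivable_inv_sub.
  - apply: derivable_ccontinuous; apply: derivable_inv_sub => //.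
    by rewrite Normc.normc0.
have ig : mu.-integrable `[0, twopi] (EFin \o (fun t => Re (g (0 + z * cexpi t)))).
  apply: itv_integrable => t _; apply: derivable_Re_circle.
  exact: derivable_inv_sub.
have Reg t : Re ((1 + d)%:C - f (0 + z * cexpi t)) >= d.
  have := Re_f (zt t); case: (f _) => a b /=; lra.
have g0 t : 0 <= Re (g (0 + z * cexpi t)).
  rewrite /g Re_inv divr_ge0 ?sqr_ge0 //.
  by rewrite (le_trans _ (Reg t)) // ltW.
have fint : (\int[mu]_(t in `[0%R, twopi]) (Re (g (0 + z * cexpi t)))%:E)%E \is a fin_num.
  exact: integrable_fin_num.
move: mean; rewrite /Rintegral -lee_fin fineK // => mean.
have d40 : 0 < 4 * d by rewrite mulr_gt0.
rewrite EFinM -lee_pdivrMl //; apply: le_trans mean.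
have SI : S `<=` `[0, twopi] by move=> t /SE[h _]; rewrite /= in_itv.
have mg := measurable_int _ ig.
apply: (@le_trans _ _ (\int[mu]_(t in S) (Re (g (0 + z * cexpi t)))%:E)%E); last first.
  apply: ge0_subset_integral => //.
  by move=> t _; rewrite lee_fin.
rewrite -integral_cst //; apply: ge0_le_integral => //.
- by move=> t _; rewrite lee_fin invr_ge0 ltW.
- exact: measurable_funS mg.
move=> t /SE[_ [h1 h2]]; rewrite lee_fin; apply: Re_inv_ge => //.
rewrite add0r -rotE; have := normcD d%:C (1 - f (complex_of_pair (rotation (cos t) (sin t) p))).
have -> : d%:C + (1 - f (complex_of_pair (rotation (cos t) (sin t) p))) =
  (1 + d)%:C - f (complex_of_pair (rotation (cos t) (sin t) p)).
  by rewrite rmorphD rmorph1; ring.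
rewrite normc_real gtr0_norm //; move: h2; lra.
Qed.

End NearOne.

Lemma area_sigma_finite : sigma_finite [set: mR * mR] area.
Proof.
exists (fun n => disc n.+1%:R).
  apply/seteqP; split => // p _; exists (Num.truncn (normc (complex_of_pair p))) => //.
  exact: truncnS_gt.
move=> n; split; first exact: measurable_disc.
rewrite area_disc //; apply: (@le_lt_trans _ _ ((n.+1%:R ^+ 2)%:E * 4%:E)%E).
  by rewrite lee_pmul2l ?lte_fin ?exprn_gt0 // area_unit_disc_le.
by rewrite -EFinM ltry.
Qed.

(** The same set function as [mu \x mu], packed as a sigma-finite measure so that
    it can be one factor of a further product. *)
Definition planar_lebesgue : {sigma_finite_measure set (mR * mR)%type -> \bar R} :=
  HB.pack area (Measure_isSigmaFinite.Build _ _ _ area area_sigma_finite).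

(** The set [visits A] is measured in two ways: each section at fixed time has
    the area of [A] by rotation invariance, and each section at a fixed point has
    length at most [k], being empty unless the point is in [B]. *)
Lemma rotation_average (A B : set (mR * mR)%type) (k : R) : 0 <= k ->
  measurable A -> measurable B ->
  (forall t p, A (rotation (cos t) (sin t) p) -> B p) ->
  (forall p, B p ->
    (mu (ysection (visits A) p) <= k%:E)%E) ->
  (twopi%:E * area A <= k%:E * area B)%E.
Proof.
move=> k0 mA mB AB Ak.
pose W := visits A; have mW : measurable W by exact: measurable_visits.
have tonelli : (\int[mu]_t area (xsection W t) = \int[area]_p mu (ysection W p))%E.
  have := @indic_fubini_tonelli _ _ _ _ R mu planar_lebesgue W mW.
  by rewrite indic_fubini_tonelli_FE // indic_fubini_tonelli_GE.
apply: (@le_trans _ _ (\int[mu]_t area (xsection W t))%E).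
  apply: (@le_trans _ _ (\int[mu]_(t in `[0%R, twopi]) area (xsection W t))%E); last first.
    apply: ge0_subset_integral => //.
    exact: (@measurable_fun_xsection _ _ _ _ _ planar_lebesgue).
  rewrite (@eq_integral _ _ _ mu `[0%R, twopi] (cst (area A))); last first.
    move=> t; rewrite inE /= in_itv /= => ht.
    rewrite /= -(area_rotation (cos2Dsin2 t) mA); congr (area _).
    apply/seteqP; split => p; rewrite /xsection /= inE; first by case.
    by move=> ?; split.
  rewrite integral_cst //= muleC lebesgue_measure_itv /= lte_fin twopi_gt0.
  by rewrite sube0.
rewrite tonelli -integral_cst // [leRHS]integral_mkcond.
apply: ge0_le_integral => //.
- exact: measurable_fun_ysection.
- by apply: (measurable_restrictT _ _).1.
move=> p _; rewrite patchE; case: ifPn => [|pB]; rewrite ?inE.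
  exact: Ak.
rewrite (_ : ysection W p = set0) ?measure0 //.
apply/seteqP; split => t //; rewrite /ysection /= inE => -[_ /AB].
by move=> Bp; move: pB; rewrite notin_setE.
Qed.

Theorem area_near_one (f : C^o -> C^o) (d : R) :
  (forall z, normc z < 1 -> derivable f z 1) -> f 0 = 0 ->
  (forall z, normc z < 1 -> normc (f z) <= 1) -> 0 < d ->
  (area (near_one f d) <= (32 * d ^+ 2)%:E)%E.
Proof.
move=> df f0 f1 d0; have mA := measurable_near_one df d.
have mB : measurable (disc 1 `\` disc (1 - d) : set (mR * mR)).
  by apply: measurableD; exact: measurable_disc.
have rotn t (p : mR * mR) : normc (complex_of_pair (rotation (cos t) (sin t) p)) =
    normc (complex_of_pair p).
  rewrite !normc_sqrtE; congr Num.sqrt; rewrite /rotation /=.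
  rewrite -[RHS]mul1r -(cos2Dsin2 t); ring.
have k0 : 0 <= 4 * d * twopi.
  by rewrite mulr_ge0 ?(ltW (twopi_gt0 R)) // mulr_ge0 // ltW.
have AB t p : near_one f d (rotation (cos t) (sin t) p) ->
    (disc 1 `\` disc (1 - d)) p.
  move=> /(near_one_annulus df f0 f1)[h1 h2]; split.
    by change (normc (complex_of_pair p) < 1); rewrite -(rotn t); exact: h1.
  move=> h3; apply: h2.
  change (normc (complex_of_pair (rotation (cos t) (sin t) p)) < 1 - d).
  by rewrite rotn; exact: h3.
have h := rotation_average k0 mA mB AB
  (fun p Bp => circle_near_one df f0 f1 d0 Bp.1).
have h2 : ((4 * d * twopi)%:E * area (disc 1 `\` disc (1 - d)) <=
    (4 * d * twopi)%:E * (8 * d)%:E)%E.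
  rewrite lee_pmul2l ?area_annulus_le // lte_fin mulr_gt0 ?twopi_gt0 //.
  by rewrite mulr_gt0.
have := le_trans h h2; rewrite -EFinM -lee_pdivlMl ?twopi_gt0 // -EFinM.
move=> /le_trans; apply; rewrite lee_fin le_eqVlt; apply/orP; left; apply/eqP.
by move: (twopi_gt0 R); move: twopi => T T0; field; rewrite gt_eqF.
Qed.

End AreaEstimate.

(** * The image measure *)

Section ImageMeasure.
Variables (R : realType) (n : nat) (phi : R[i] -> Cvec R n).
Local Open Scope complex_scope.
Local Notation C := R[i].
Local Notation normc := (@Normc.normc R).
Local Notation mu := (@lebesgue_measure R).
Local Notation area := (mu \x mu)%E.
Local Notation mR := (measurableTypeR R).
Local Notation D := (disc 1 : set (mR * mR)).
Hypothesis phi_holo : holomorphic_on_disc phi.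

Lemma unit_disc_normc (z : C) : unit_disc z = (normc z < 1) :> Prop.
Proof. by rewrite /unit_disc /= norm_normc ltcR. Qed.

Lemma preimage_unit_disc : (@complex_of_pair R) @^-1` @unit_disc R = D.
Proof. by apply/funext => p; rewrite /preimage /= unit_disc_normc. Qed.

(** Continuity of [phi]; on row vectors the topology is that of the maximum norm,
    so it is checked on each coordinate. *)
Lemma phi_near (p : mR * mR) (U : set (Cvec R n)) : D p -> open U ->
  U (phi (complex_of_pair p)) -> exists2 r : R, 0 < r &
  forall z, normc (z - complex_of_pair p) < r -> U (phi z).
Proof.
move=> Dp oU Up; set z0 := complex_of_pair p.
have /nbhs_ballP[_ /= /pos_complexP[e e0 ->] eU] := open_nbhs_nbhs (conj oU Up).
have cphi (j : 'I_n) : \forall w \near nbhs (z0 : C^o),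
    `|(phi z0 ord0 j : C^o) - phi w ord0 j| < e%:C.
  have /derivable_ccontinuous/ccontinuous_continuous : derivable
    ((fun w => phi w ord0 j) : C^o -> C^o) z0 1.
    by apply: phi_holo; rewrite unit_disc_normc.
  by move=> /(@cvgrPdist_lt _ _ _ (nbhs (z0 : C^o)) (nbhs_filter (z0 : C^o)))
    /(_ e%:C); apply; rewrite ltcR.
have [_ /= /pos_complexP[r r0 ->] hr] := filter_forall (nbhs_filter (z0 : C^o)) cphi.
exists r => // z zr; apply: eU; split => [|i j]; first by rewrite ltcR.
rewrite ord1; apply: hr.
by rewrite /ball_ /= norm_normc ltcR normc_distC.
Qed.

(** Open sets generate the Borel sets, so it suffices to see that preimages of
    open sets are open in the disc. *)
Lemma measurable_phi :
  measurable_fun D ((phi \o @complex_of_pair R) : mR * mR -> borel (Cvec R n)).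
Proof.
apply: (@measurability _ _ (mR * mR)%type (borel (Cvec R n)) D _
  (@open (Cvec R n))) => //.
move=> _ [U oU <-]; apply: measurable_open_complex => p [Dp Up].
have [r r0 hr] := phi_near Dp oU Up.
have [s s0 hs] := disc_near Dp.
exists (Num.min r s); first by rewrite lt_min r0.
by move=> q; rewrite lt_min => /andP[/hr Uq /hs Dq].
Qed.

Definition weight (p : mR * mR) : R := (1 - (p.1 ^+ 2 + p.2 ^+ 2)) ^+ (n - 2).

Lemma measurable_weight : measurable_fun setT (EFin \o weight).
Proof.
apply/measurable_EFinP; apply: measurable_funX; apply: measurable_funB => //.
by apply: measurable_funD; apply: measurable_funX.
Qed.

Lemma weightE p : weight p = (1 - normc (complex_of_pair p) ^+ 2) ^+ (n - 2).
Proof. by rewrite normc2E. Qed.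

Lemma weight_ge0 p : D p -> 0 <= weight p.
Proof.
move=> Dp; rewrite weightE exprn_ge0 // subr_ge0 expr_le1 ?normc_ge0 //.
exact: ltW.
Qed.

Lemma image_measureE A : image_measure phi A =
  (\int[area]_(p in D `&` (phi \o @complex_of_pair R) @^-1` A) (weight p)%:E)%E.
Proof. by rewrite /image_measure /pushforward /weighted_area preimage_unit_disc. Qed.

Lemma measurable_image_set (A : set (borel (Cvec R n))) : measurable A ->
  measurable (D `&` (phi \o @complex_of_pair R) @^-1` A).
Proof. by move=> mA; apply: measurable_phi => //; exact: measurable_disc. Qed.

Let nu := image_measure phi.

Let nu0 : nu set0 = 0%E.
Proof. by rewrite /nu image_measureE preimage_set0 setI0 integral_set0. Qed.

Let nu_ge0 A : (0 <= nu A)%E.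
Proof.
rewrite /nu image_measureE; apply: integral_ge0 => p [Dp _].
by rewrite lee_fin weight_ge0.
Qed.

Let nu_sigma_additive : semi_sigma_additive nu.
Proof.
move=> F mF tF mUF; rewrite /nu image_measureE.
rewrite preimage_bigcup setI_bigcupr ge0_integral_bigcup //; first last.
- apply/trivIsetP => i j _ _ ij; move/trivIsetP : tF => /(_ i j I I ij) Fij.
  apply/seteqP; split => // p [[_ Fi] [_ Fj]].
  by have : (F i `&` F j) (phi (complex_of_pair p)) by []; rewrite Fij.
- by move=> p [i _ [Dp _]]; rewrite lee_fin weight_ge0.
- exact: measurable_funTS measurable_weight.
- by move=> k; exact: measurable_image_set.
under eq_fun do under eq_bigr do rewrite image_measureE.
apply: is_cvg_nneseries => k _ _; apply: integral_ge0 => p [Dp _].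
by rewrite lee_fin weight_ge0.
Qed.

HB.instance Definition _ := isMeasure.Build _ _ _ nu nu0 nu_ge0 nu_sigma_additive.

(** Factor [1 - |z|^2 = (1 + |z|) (1 - |z|)], with [1 + |z| <= 2] and
    [1 - |z| <= d]. *)
Lemma weight_le p (d : R) : D p -> ~ disc (1 - d) p -> weight p <= (2 * d) ^+ (n - 2).
Proof.
move=> Dp /negP; rewrite -leNgt => dp.
have {}Dp : normc (complex_of_pair p) < 1 by [].
have {}dp : 1 - d <= normc (complex_of_pair p) by [].
have n0 := normc_ge0 (complex_of_pair p).
rewrite weightE lerXn2r ?nnegrE ?subr_ge0 ?expr_le1 ?(ltW Dp) //.
  by rewrite mulr_ge0 //; lra.
have -> : 1 - normc (complex_of_pair p) ^+ 2 =
  (1 + normc (complex_of_pair p)) * (1 - normc (complex_of_pair p)) by ring.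
by apply: ler_pM; lra.
Qed.

Let nu_fin : fin_num_fun nu.
Proof.
move=> A mA; rewrite ge0_fin_numE //; apply: (@le_lt_trans _ _ (area D)); last first.
  by rewrite (le_lt_trans (area_unit_disc_le R)) // ltry.
rewrite /nu image_measureE -[leRHS]mul1e -integral_cst; last exact: measurable_disc.
apply: (@le_trans _ _ (\int[area]_(p in D) (weight p)%:E)%E).
  apply: ge0_subset_integral => //; [exact: measurable_image_set|exact: measurable_disc| |].
    exact: measurable_funTS measurable_weight.
  by move=> p Dp; rewrite lee_fin weight_ge0.
apply: ge0_le_integral => //; first exact: measurable_disc.
- by move=> p Dp; rewrite lee_fin weight_ge0.
- exact: measurable_funTS measurable_weight.
move=> p Dp; rewrite lee_fin weightE exprn_ile1 // ?subr_ge0 ?expr_le1 ?normc_ge0 //.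
  exact: ltW.
by rewrite gerBl sqr_ge0.
Qed.

HB.instance Definition _ := Measure_isFinite.Build _ _ _ nu nu_fin.

Lemma image_measure_finite :
  (forall z : C, unit_disc z -> unit_ball (phi z)) ->
  finite_borel_measure_on_ball (image_measure phi).
Proof.
move=> phi_ball; split.
  by exists [the {finite_measure set (borel (Cvec R n)) -> \bar R} of nu].
rewrite image_measureE (_ : _ `&` _ = set0) ?integral_set0 //.
apply/seteqP; split => // p [Dp]; apply; apply: phi_ball.
by rewrite unit_disc_normc.
Qed.

End ImageMeasure.

(** * Slices of phi and the Carleson condition *)

Section SliceFunction.
Variables (R : realType) (n : nat).
Local Open Scope complex_scope.
Local Notation C := R[i].
Local Notation normc := (@Normc.normc R).
Local Notation mR := (measurableTypeR R).

(** The conjugate makes this function holomorphic: [hdot] is conjugate-linear in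
    its second argument. *)
Definition slice (phi : C -> Cvec R n) (zeta : Cvec R n) : C^o -> C^o :=
  fun z => (hdot zeta (phi z))^*.

Lemma sliceE phi zeta z :
  slice phi zeta z = \sum_(j < n) (zeta ord0 j : C)^* * phi z ord0 j.
Proof.
rewrite /slice /hdot rmorph_sum; apply: eq_bigr => j _.
by rewrite rmorphM /= conjcK.
Qed.

Lemma derivable_slice phi zeta z : holomorphic_on_disc phi -> unit_disc z ->
  derivable (slice phi zeta) z 1.
Proof.
move=> dphi z1; rewrite (_ : slice phi zeta = \sum_(j < n)
    (fun w : C^o => (zeta ord0 j : C)^* *: (phi w ord0 j : C^o))); last first.
  by apply/funext => w; rewrite sliceE fct_sumE.
apply: derivable_sum => j.
exact: (@derivableZ C C^o C^o _ (zeta ord0 j : C)^* z 1 (dphi j z z1)).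
Qed.

Lemma normc_sum (I : finType) (F : I -> C) : normc (\sum_i F i) <= \sum_i normc (F i).
Proof.
elim/big_ind2: _ => [|x a y b xa yb|//]; first by rewrite Normc.normc0.
by apply: le_trans (normcD _ _) _; rewrite lerD.
Qed.

Lemma sum_sqr_normc (x : Cvec R n) :
  \sum_(j < n) `|x ord0 j| ^+ 2 = (\sum_(j < n) normc (x ord0 j) ^+ 2)%:C.
Proof.
by rewrite rmorph_sum; apply: eq_bigr => j _; rewrite norm_normc rmorphXn.
Qed.

(** The inequality [a b <= (a^2 + b^2) / 2] on each coordinate replaces that of
    Cauchy and Schwarz, as both sums of squares are at most 1. *)
Lemma normc_slice phi zeta z : unit_sphere zeta -> unit_ball (phi z) ->
  normc (slice phi zeta z) <= 1.
Proof.
rewrite /unit_sphere /unit_ball /= !sum_sqr_normc => /(@complexI R) h1.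
rewrite (_ : 1 = 1%:C) // ltcR => h2.
rewrite sliceE; apply: le_trans (normc_sum _) _.
apply: (@le_trans _ _ (\sum_(j < n) (normc (zeta ord0 j) ^+ 2 / 2 +
    normc (phi z ord0 j) ^+ 2 / 2))).
  apply: ler_sum => j _; rewrite normcM normc_conj.
  have := sqr_ge0 (normc (zeta ord0 j) - normc (phi z ord0 j)); lra.
rewrite big_split /= -!mulr_suml; move: h1 h2; lra.
Qed.

Lemma carleson_region_slice phi zeta (d : R) z : unit_ball (phi z) ->
  carleson_region zeta d (phi z) <-> normc (1 - slice phi zeta z) < d.
Proof.
move=> bz; rewrite /carleson_region /= norm_normc ltcR.
rewrite (_ : normc (1 - slice phi zeta z) = normc (1 - hdot zeta (phi z))).
  by split => [[]|].
by rewrite -[RHS]normc_conj rmorphB rmorph1.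
Qed.

End SliceFunction.

Unset Implicit Arguments.
Set Strict Implicit.
Set Printing Implicit Defensive.

Theorem theorem2p5 (R : realType) (n : nat) (phi : R[i] -> Cvec R n)
  (hn : (2 <= n)%N)
  (phi_holo : holomorphic_on_disc phi)
  (phi_ball : forall z : R[i], unit_disc z -> unit_ball (phi z))
  (phi0 : phi 0 = 0) :
  carleson_measure (image_measure phi).
Proof.
split; first exact: image_measure_finite.
exists (32 * 2 ^+ (n - 2)) => zeta d hzeta d0.
set f := slice phi zeta.
have df (z : R[i]) : Normc.normc z < 1 -> derivable f z 1.
  by move=> z1; apply: derivable_slice => //; rewrite unit_disc_normc.
have f0 : f 0 = 0.
  by rewrite /f sliceE phi0 big1 // => j _; rewrite mxE mulr0.
have f1 (z : R[i]) : Normc.normc z < 1 -> Normc.normc (f z) <= 1.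
  by move=> z1; apply: normc_slice => //; apply: phi_ball; rewrite unit_disc_normc.
have mS := measurable_near_one df d.
rewrite image_measureE (_ : _ `&` _ = near_one f d); last first.
  apply/seteqP; split => p [p1] /=;
    have pb : unit_ball (phi (complex_of_pair p));
    try (by apply: phi_ball; rewrite unit_disc_normc).
  - by move=> /(carleson_region_slice zeta d pb); split.
  - by move=> h; split => //; apply/(carleson_region_slice zeta d pb).
apply: (@le_trans _ _ (((2 * d) ^+ (n - 2))%:E *
    (lebesgue_measure \x lebesgue_measure)%E (near_one f d))%E).
  rewrite -integral_cst //; apply: ge0_le_integral => //.
  - by move=> p [p1 _]; rewrite lee_fin weight_ge0.
  - exact: measurable_funTS (@measurable_weight R n).
  - move=> p /(near_one_annulus df f0 f1)[p1 p2].
    by rewrite lee_fin weight_le.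
apply: (@le_trans _ _ (((2 * d) ^+ (n - 2))%:E * (32 * d ^+ 2)%:E)%E).
  by rewrite lee_pmul2l ?lte_fin ?exprn_gt0 ?mulr_gt0 // area_near_one.
rewrite -EFinM lee_fin le_eqVlt; apply/orP; left; apply/eqP.
by rewrite exprMn -{4}(subnK hn) exprD; ring.
Qed.
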